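(* Let $\mathfrak{g}$ be a finite dimensional complex Lie algebra and $(\tau,V_\tau)$ a finite dimensional complex representation of $\mathfrak{g}$. For $\mathcal{A},\mathcal{B}\in\widetilde{\mathcal{C}_\tau}(\mathfrak{g})$ the star-product $*_t$ on $\widetilde{\mathcal{C}_\tau}(\mathfrak{g})$ can be written as $$\mathcal{A}*_t\mathcal{B}=\mathcal{A}\mathcal{B}+\frac{t}{2}\{\mathcal{A},\mathcal{B}\}+O(t^2).$$ That is, the first-order term of the $1$-parameter formal deformation from $\widetilde{\mathcal{C}_\tau}(\mathfrak{g})$ to $\widetilde{\mathcal{Q}_\tau}(\mathfrak{g})$ given by $*_t$ is $\frac12$ times the noncommutative Poisson bracket.
   Context: Let $S(\mathfrak{g})$ and $U(\mathfrak{g})$ be the symmetric and universal enveloping algebras, and set $\widetilde{\mathcal{C}_\tau}(\mathfrak{g}):=\mathrm{End}_{\mathbb{C}}V_\tau\otimes_{\mathbb{C}}S(\mathfrak{g})$, $\widetilde{\mathcal{Q}_\tau}(\mathfrak{g}):=\mathrm{End}_{\mathbb{C}}V_\tau\otimes_{\mathbb{C}}U(\mathfrak{g})$, with products $(A\otimes a)(B\otimes b)=AB\otimes ab$. Let $\{X_i\}$ be a basis of $\mathfrak{g}$ with $[X_i,X_j]=c^k_{ij}X_k$ (summation convention), and $\partial^i$ the partial derivative on $S(\mathfrak{g})$ with respect to $X_i$. The Poisson bracket on $S(\mathfrak{g})$ is $\{a,b\}=c^k_{ij}X_k\cdot\partial^i a\cdot\partial^j b$. The noncommutative Poisson bracket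 on $\widetilde{\mathcal{C}_\tau}(\mathfrak{g})$ is the bilinear map with $\{A\otimes a,B\otimes b\}:=AB\otimes\{a,b\}$. For a parameter $t$, let $U_t(\mathfrak{g})=T(\mathfrak{g})/(X\otimes Y-Y\otimes X-t[X,Y])$, where $T(\mathfrak{g})$ is the tensor algebra; so $U_0(\mathfrak{g})=S(\mathfrak{g})$, $U_1(\mathfrak{g})=U(\mathfrak{g})$. Let $\widetilde{\mathcal{Q}^t_\tau}(\mathfrak{g}):=\mathrm{End}_{\mathbb{C}}V_\tau\otimes U_t(\mathfrak{g})$. The Poincaré–Birkhoff–Witt (symmetrization) map $\mathrm{I}_{\mathrm{PBW}}:S(\mathfrak{g})\to U_t(\mathfrak{g})$ is the linear isomorphism with $Y_1\cdots Y_k\mapsto\frac{1}{k!}\sum_{\sigma\in S_k}Y_{\sigma(1)}\cdots Y_{\sigma(k)}$ for $Y_1,\dots,Y_k\in\mathfrak{g}$. Put $\mathrm{F}_{\mathrm{PBW}}:=\mathrm{Id}\otimes\mathrm{I}_{\mathrm{PBW}}:\widetilde{\mathcal{C}_\tau}(\mathfrak{g})\to\widetilde{\mathcal{Q}^t_\tau}(\mathfrak{g})$. The star-product is $\mathcal{A}*_t\mathcal{B}:=\mathrm{F}_{\mathrm{PBW}}^{-1}(\mathrm{F}_{\mathrm{PBW}}(\mathcal{A})\cdot\mathrm{F}_{\mathrm{PBW}}(\mathcal{B}))$. For given $\mathcal{A},\mathcal{B}$, it depends polynomially on $t$, and $O(t^2)$ denotes $t^2$ times a polynomial in $t$ with coefficients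 in $\widetilde{\mathcal{C}_\tau}(\mathfrak{g})$. *)

(* Defs.v *)
From HB Require Import structures.
From mathcomp Require Import all_boot all_order all_algebra all_fingroup.
From mathcomp Require Import generic_quotient ring_quotient sesquilinear complex.
From mathcomp Require Import finmap boolp classical_sets reals.
From mathcomp Require Import monalg.

Set Implicit Arguments.
Unset Strict Implicit.
Unset Printing Implicit Defensive.

Import GRing.Theory.
Local Open Scope ring_scope.
Local Open Scope quotient_scope.

Section LinearQuotient.
Variables (K : fieldType) (M : lmodType K) (G : M -> Prop).

(* The submodule spanned by G. *)
Inductive lspan : M -> Prop :=
| lspan0 : lspan 0
| lspanS a u v : G u -> lspan v -> lspan (a *: u + v).

Lemma lspan_sub u : G u -> lspan u.
Proof.
by move=> Gu; rewrite -[u]scale1r -[_ *: _]addr0; apply: lspanS lspan0.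
Qed.

Lemma lspanZD a u v : lspan u -> lspan v -> lspan (a *: u + v).
Proof.
move=> hu hv; elim: hu => [|b w w' Gw _ IH]; first by rewrite scaler0 add0r.
by rewrite scalerDr scalerA -addrA; constructor.
Qed.

Definition lspan_pred : pred M := fun u => `[< lspan u >].

Lemma lspan_predP : zmod_closed lspan_pred.
Proof.
split=> [|u v /asboolP hu /asboolP hv]; apply/asboolP; first exact: lspan0.
by rewrite addrC -scaleN1r; apply: lspanZD.
Qed.
HB.instance Definition _ := GRing.isZmodClosed.Build M lspan_pred lspan_predP.

Definition lquot := Quotient.quot (GRing.ZmodClosed.clone M lspan_pred _).
HB.instance Definition _ := GRing.Zmodule.on lquot.

Definition lpi (u : M) : lquot := \pi u.
Definition lrepr (x : lquot) : M := repr x.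

Lemma lpiP u v : lpi u = lpi v <-> lspan (u - v).
Proof.
by split=> [/eqP|h]; [|apply/eqP]; rewrite -Quotient.idealrBE; [move/asboolP|apply/asboolP].
Qed.
Lemma lreprK : cancel lrepr lpi. Proof. exact: reprK. Qed.
Lemma lpiD u v : lpi (u + v) = lpi u + lpi v. Proof. exact: raddfD. Qed.
Lemma lpi_lrepr u : lspan (lrepr (lpi u) - u).
Proof. by apply/lpiP; rewrite lreprK. Qed.

Fact lquot_key : unit. Proof. by []. Qed.
Definition lscale : K -> lquot -> lquot :=
  locked_with lquot_key (fun a x => lpi (a *: lrepr x)).

Lemma lpiZ a u : lpi (a *: u) = lscale a (lpi u).
Proof.
rewrite /lscale unlock; apply/esym/lpiP; rewrite -scalerBr -[_ *: _]addr0.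
by apply: lspanZD (lspan0); apply: lpi_lrepr.
Qed.

Fact lscaleA a b x : lscale a (lscale b x) = lscale (a * b) x.
Proof. by rewrite -[x]lreprK -!lpiZ scalerA. Qed.
Fact lscale1 : left_id 1 lscale.
Proof. by move=> x; rewrite -[x]lreprK -!lpiZ scale1r. Qed.
Fact lscaleDr : right_distributive lscale +%R.
Proof.
by move=> a x y; rewrite -[x]lreprK -[y]lreprK -lpiD -!lpiZ scalerDr lpiD.
Qed.
Fact lscaleDl x : {morph lscale^~ x : a b / a + b}.
Proof. by move=> a b; rewrite -[x]lreprK -!lpiZ scalerDl lpiD. Qed.

HB.instance Definition _ := GRing.Zmodule_isLmodule.Build K lquot
  lscaleA lscale1 lscaleDr lscaleDl.

Lemma lpi_scale a u : lpi (a *: u) = a *: lpi u. Proof. exact: lpiZ. Qed.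
Lemma lpi_is_linear : linear lpi.
Proof. by move=> a u v; rewrite lpiD lpiZ. Qed.
HB.instance Definition _ := GRing.isLinear.Build K M lquot _ lpi lpi_is_linear.

End LinearQuotient.

Section AlgebraQuotient.
Variables (K : fieldType) (A : algType K) (G : A -> Prop).

(* The two-sided ideal generated by G. *)
Inductive tsideal : A -> Prop :=
| tsideal0 : tsideal 0
| tsidealS a u b v : G u -> tsideal v -> tsideal (a * u * b + v).

Lemma tsideal_sub u : G u -> tsideal u.
Proof.
by move=> Gu; rewrite -[u]mul1r -[_ * u]mulr1 -[_ * _]addr0;
  apply: tsidealS tsideal0.
Qed.

Lemma tsidealD u v : tsideal u -> tsideal v -> tsideal (u + v).
Proof.
move=> hu hv; elim: hu => [|a w b w' Gw _ IH]; first by rewrite add0r.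
by rewrite -addrA; constructor.
Qed.

Lemma tsidealM a u b : tsideal u -> tsideal (a * u * b).
Proof.
elim=> [|c w d w' Gw _ IH]; first by rewrite mulr0 mul0r; constructor.
by rewrite mulrDr mulrDl !mulrA -(mulrA _ d); constructor.
Qed.

Lemma tsideal_rmorph (B : pzRingType) (e : {rmorphism A -> B}) :
  (forall u, G u -> e u = 0) -> forall u, tsideal u -> e u = 0.
Proof.
move=> eG u; elim=> [|a v b w Gv _ IH]; first by rewrite rmorph0.
by rewrite rmorphD !rmorphM /= (eG v Gv) mulr0 mul0r IH addr0.
Qed.

Definition tsideal_pred : pred A := fun u => `[< tsideal u >].

Lemma tsideal_predP : zmod_closed tsideal_pred.
Proof.
split=> [|u v /asboolP hu /asboolP hv]; apply/asboolP; first exact: tsideal0.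
by apply: tsidealD => //; rewrite -mulN1r -[_ * _]mulr1; apply: tsidealM.
Qed.
HB.instance Definition _ :=
  GRing.isZmodClosed.Build A tsideal_pred tsideal_predP.

Definition aquot := Quotient.quot (GRing.ZmodClosed.clone A tsideal_pred _).
HB.instance Definition _ := GRing.Zmodule.on aquot.

Definition api (u : A) : aquot := \pi u.
Definition arepr (x : aquot) : A := repr x.

Lemma apiP u v : api u = api v <-> tsideal (u - v).
Proof.
by split=> [/eqP|h]; [|apply/eqP]; rewrite -Quotient.idealrBE; [move/asboolP|apply/asboolP].
Qed.
Lemma areprK : cancel arepr api. Proof. exact: reprK. Qed.
Lemma apiD u v : api (u + v) = api u + api v. Proof. exact: raddfD. Qed.
Lemma api_arepr u : tsideal (arepr (api u) - u).
Proof. by apply/apiP; rewrite areprK. Qed.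

Definition aone : aquot := api 1.
Fact aquot_key : unit. Proof. by []. Qed.
Definition amul : aquot -> aquot -> aquot :=
  locked_with aquot_key (fun x y => api (arepr x * arepr y)).
Definition ascale : K -> aquot -> aquot :=
  locked_with aquot_key (fun a x => api (a *: arepr x)).

Lemma apiM u v : api (u * v) = amul (api u) (api v).
Proof.
rewrite /amul unlock; apply/esym/apiP; set u' := arepr _; set v' := arepr _.
have -> : u' * v' - u * v = 1 * (u' - u) * v' + u * (v' - v) * 1.
  by rewrite mul1r mulr1 mulrBl mulrBr addrA subrK.
by apply: tsidealD; apply: tsidealM; apply: api_arepr.
Qed.

Lemma apiZ a u : api (a *: u) = ascale a (api u).
Proof.
rewrite /ascale unlock; apply/esym/apiP; rewrite -scalerBr -[X in a *: X]mul1r scalerAl.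
by rewrite -[_ * _]mulr1; apply: tsidealM; apply: api_arepr.
Qed.

Fact amulA : associative amul.
Proof.
by move=> x y z; rewrite -[x]areprK -[y]areprK -[z]areprK -!apiM mulrA.
Qed.
Fact amul1 : left_id aone amul.
Proof. by move=> x; rewrite -[x]areprK -apiM mul1r. Qed.
Fact amulr1 : right_id aone amul.
Proof. by move=> x; rewrite -[x]areprK -apiM mulr1. Qed.
Fact amulDl : left_distributive amul +%R.
Proof.
move=> x y z; rewrite -[x]areprK -[y]areprK -[z]areprK.
by rewrite -(apiD (arepr x)) -!apiM mulrDl apiD.
Qed.
Fact amulDr : right_distributive amul +%R.
Proof.
move=> x y z; rewrite -[x]areprK -[y]areprK -[z]areprK.
by rewrite -(apiD (arepr y)) -!apiM mulrDr apiD.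
Qed.
HB.instance Definition _ := GRing.Zmodule_isPzRing.Build aquot
  amulA amul1 amulr1 amulDl amulDr.

Fact ascaleA a b x : ascale a (ascale b x) = ascale (a * b) x.
Proof. by rewrite -[x]areprK -!apiZ scalerA. Qed.
Fact ascale1 : left_id 1 ascale.
Proof. by move=> x; rewrite -[x]areprK -!apiZ scale1r. Qed.
Fact ascaleDr : right_distributive ascale +%R.
Proof.
by move=> a x y; rewrite -[x]areprK -[y]areprK -apiD -!apiZ scalerDr apiD.
Qed.
Fact ascaleDl x : {morph ascale^~ x : a b / a + b}.
Proof. by move=> a b; rewrite -[x]areprK -!apiZ scalerDl apiD. Qed.
HB.instance Definition _ := GRing.Zmodule_isLmodule.Build K aquot
  ascaleA ascale1 ascaleDr ascaleDl.

Lemma api_is_linear : linear api.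
Proof. by move=> a u v; rewrite apiD apiZ. Qed.
HB.instance Definition _ := GRing.isLinear.Build K A aquot _ api api_is_linear.
Lemma api_is_monoid_morphism : monoid_morphism api.
Proof. by split=> // u v; rewrite apiM. Qed.
HB.instance Definition _ :=
  GRing.isMonoidMorphism.Build A aquot api api_is_monoid_morphism.

Lemma aquot_scalerAl (a : K) (x y : aquot) : a *: (x * y) = (a *: x) * y.
Proof.
rewrite -[x]areprK -[y]areprK; move: (arepr x) (arepr y) => u v.
have apiZ' w : a *: api w = api (a *: w) by rewrite linearZ.
by rewrite apiZ' -!(rmorphM api) apiZ' scalerAl.
Qed.
Lemma aquot_scalerAr (a : K) (x y : aquot) : a *: (x * y) = x * (a *: y).
Proof.
rewrite -[x]areprK -[y]areprK; move: (arepr x) (arepr y) => u v.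
have apiZ' w : a *: api w = api (a *: w) by rewrite linearZ.
by rewrite apiZ' -!(rmorphM api) apiZ' scalerAr.
Qed.

End AlgebraQuotient.

Section TensorProduct.
Variables (K : fieldType) (E A : lmodType K).

(* E (x) A is the free module on E * A modulo the bilinearity relations. *)
Inductive tensor_rel : {malg K[(E * A)%type]} -> Prop :=
| tensor_relDl x y a : tensor_rel (<< (x + y, a) >> - << (x, a) >> - << (y, a) >>)
| tensor_relDr x a b : tensor_rel (<< (x, a + b) >> - << (x, a) >> - << (x, b) >>)
| tensor_relZl c x a : tensor_rel (<< (c *: x, a) >> - c *: << (x, a) >>)
| tensor_relZr c x a : tensor_rel (<< (x, c *: a) >> - c *: << (x, a) >>).

Definition tensor := lquot tensor_rel.
HB.instance Definition _ := GRing.Lmodule.on tensor.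

Definition tpure (x : E) (a : A) : tensor := lpi _ << (x, a) >>.

Lemma tpure_bilinear : bilinear_for *:%R *:%R tpure.
Proof.
have lin u v : tensor_rel (u - v) -> lpi tensor_rel u = lpi _ v.
  by move=> h; apply/lpiP/lspan_sub.
have Z (c : K) u : c *: (lpi tensor_rel u : tensor) = lpi _ (c *: u).
  exact/esym/lpiZ.
split=> [a c x y|x c a b] /=; rewrite /tpure Z.
  transitivity (lpi tensor_rel (<< (c *: x, a) >> + << (y, a) >>)).
    by apply: lin; rewrite opprD addrA; exact: tensor_relDl.
  by rewrite lpiD (lin _ _ (tensor_relZl c x a)).
transitivity (lpi tensor_rel (<< (x, c *: a) >> + << (x, b) >>)).
  by apply: lin; rewrite opprD addrA; exact: tensor_relDr.
by rewrite lpiD (lin _ _ (tensor_relZr c x a)).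
Qed.

Lemma tensor_ind (P : tensor -> Prop) :
    (forall x a, P (tpure x a)) -> P 0 ->
    (forall c u v, P u -> P v -> P (c *: u + v)) ->
  forall u, P u.
Proof.
move=> hp h0 hD u; rewrite -[u]lreprK; move: (lrepr u) => w.
rewrite [w]monalgE raddf_sum /=.
apply: (big_ind P) => // [v v' hv hv'|[x a] _].
  by rewrite -[v]scale1r; apply: hD.
have -> : << w@_(x, a) *g (x, a) >> = w@_(x, a) *: << (x, a) >>.
  by apply/malgP => k; rewrite mcoeffZ !mcoeffU mulr_natr.
by rewrite lpi_scale -[_ *: _]addr0; apply: hD => //; apply: hp.
Qed.

(* The linear map on E (x) A induced by f; meaningful only when f is bilinear, see
   [tensor_lift_linear] and [tensor_lift_pure]. *)
Definition tensor_lift (W : lmodType K) (f : E -> A -> W) (u : tensor) : W :=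
  \sum_(k <- msupp (lrepr u)) (lrepr u)@_k *: f k.1 k.2.

Section Lift.
Variables (W : lmodType K) (f : E -> A -> W).
Hypothesis f_bilin : bilinear_for *:%R *:%R f.

Let ext (w : {malg K[(E * A)%type]}) : W :=
  \sum_(k <- msupp w) w@_k *: f k.1 k.2.

Let extEw (d : {fset (E * A)%type}) w : (msupp w `<=` d)%fset ->
  ext w = \sum_(k <- d) w@_k *: f k.1 k.2.
Proof.
move=> le; rewrite /ext (big_fset_incl _ le) => //= x xd /mcoeff_outdom ->.
by rewrite scale0r.
Qed.

Let ext_linear : linear ext.
Proof.
move=> c u v; pose d := (msupp u `|` msupp v `|` msupp (c *: u + v))%fset.
have du : (msupp u `<=` d)%fset by rewrite /d -fsetUA fsubsetUl.
have dv : (msupp v `<=` d)%fset by rewrite /d fsetUAC fsubsetUr.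
rewrite (extEw du) (extEw dv) (@extEw d) ?fsubsetUr //.
rewrite scaler_sumr -big_split /=; apply: eq_bigr => k _.
by rewrite mcoeffD mcoeffZ scalerDl scalerA.
Qed.

Let extU k : ext << k >> = f k.1 k.2.
Proof. by rewrite (extEw msuppU_le) big_seq_fset1 mcoeffUU scale1r. Qed.

Let extB u v : ext (u - v) = ext u - ext v.
Proof. by rewrite [u - v]addrC -[- v]scaleN1r ext_linear scaleN1r addrC. Qed.
Let extZ c u : ext (c *: u) = c *: ext u.
Proof.
have e0 : ext 0 = 0 by rewrite -(subrr 0) extB subrr.
by rewrite -[_ *: u]addr0 ext_linear e0 addr0.
Qed.

Let ext_span w : lspan tensor_rel w -> ext w = 0.
Proof.
have [fl fr] := f_bilin.
elim=> [|c u v hu _ IH]; first by rewrite -(subrr 0) extB subrr.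
rewrite ext_linear IH addr0; suff -> : ext u = 0 by rewrite scaler0.
case: hu => [x y a|x a b|c' x a|c' x a]; rewrite !extB ?extZ !extU /=.
- have /= := fl a 1 x y; rewrite !scale1r => ->.
  by rewrite [_ + f y a]addrC addrK subrr.
- have /= := fr x 1 a b; rewrite !scale1r => ->.
  by rewrite [_ + f x b]addrC addrK subrr.
- have f0 : f 0 a = 0 by have /= := fl a (-1) 0 0; rewrite addr0 scaler0 scaleN1r addNr.
  by have /= := fl a c' x 0; rewrite f0 !addr0 => ->; rewrite subrr.
- have f0 : f x 0 = 0 by have /= := fr x (-1) 0 0; rewrite addr0 scaler0 scaleN1r addNr.
  by have /= := fr x c' a 0; rewrite f0 !addr0 => ->; rewrite subrr.
Qed.

Let ext_lrepr w : ext (lrepr (lpi tensor_rel w)) = ext w.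
Proof.
by apply/eqP; rewrite -subr_eq0 -extB; apply/eqP/ext_span/lpi_lrepr.
Qed.

Lemma tensor_lift_pure x a : tensor_lift f (tpure x a) = f x a.
Proof. by rewrite [LHS]ext_lrepr extU. Qed.

Lemma tensor_lift_linear : linear (tensor_lift f).
Proof.
move=> c u v; rewrite -[u]lreprK -[v]lreprK -lpi_scale -lpiD.
by rewrite /tensor_lift -!/(ext _) !ext_lrepr ext_linear.
Qed.

End Lift.
End TensorProduct.

(* The bilinear map with (x (x) a, y (x) b) |-> f x y (x) h a b, for bilinear f
   and h. *)
Section TensorMap2.
Variables (K : fieldType) (E A : lmodType K).
Variables (f : E -> E -> E) (h : A -> A -> A).

Definition tensor_map2 (u v : tensor E A) : tensor E A :=
  tensor_lift (fun x a => tensor_lift (fun y b => tpure (f x y) (h a b)) v) u.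

Hypothesis f_bilin : bilinear_for *:%R *:%R f.
Hypothesis h_bilin : bilinear_for *:%R *:%R h.

Let inner_bilin x a :
  bilinear_for *:%R *:%R (fun y b => tpure (f x y) (h a b)).
Proof.
have [[_ fr] [_ hr]] := (f_bilin, h_bilin).
have [pl pr] := @tpure_bilinear K E A.
split=> [b c y z|y c b d] /=; first by rewrite (fr x c y z) [LHS]pl.
by rewrite (hr a c b d) [LHS]pr.
Qed.

Let outer_bilin v : bilinear_for *:%R *:%R
  (fun x a => tensor_lift (fun y b => tpure (f x y) (h a b)) v).
Proof.
have [[fl _] [hl _]] := (f_bilin, h_bilin).
have [pl pr] := @tpure_bilinear K E A.
pose T x a := tensor_lift (fun y b => tpure (f x y) (h a b)).
have TD x a c u w : T x a (c *: u + w) = c *: T x a u + T x a w.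
  exact: (tensor_lift_linear (inner_bilin x a)).
have T0 x a : T x a 0 = 0.
  by have := TD x a (-1) 0 0; rewrite scaler0 addr0 scaleN1r addNr.
have sw c (p q r s : tensor E A) (e : K) :
  e *: (c *: p + q) + (c *: r + s) = c *: (e *: p + r) + (e *: q + s).
  by rewrite !scalerDr !scalerA mulrC addrACA.
split=> [a c x y|x c a d] /=; rewrite -!/(T _ _ _).
  elim/tensor_ind: v => [z b||e u w IHu IHw].
  - rewrite /T !tensor_lift_pure //.
    by have /= -> := fl z c x y; exact: pl.
  - by rewrite !T0 scaler0 addr0.
  - rewrite (TD _ _ e u w) (TD x a e u w) (TD y a e u w) IHu IHw; exact: sw.
elim/tensor_ind: v => [z b||e u w IHu IHw].
- rewrite /T !tensor_lift_pure //.
  by have /= -> := hl b c a d; exact: pr.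
- by rewrite !T0 scaler0 addr0.
- rewrite (TD _ _ e u w) (TD x a e u w) (TD x d e u w) IHu IHw; exact: sw.
Qed.

Lemma tensor_map2_pure x y a b :
  tensor_map2 (tpure x a) (tpure y b) = tpure (f x y) (h a b).
Proof. by rewrite /tensor_map2 (tensor_lift_pure (outer_bilin _)) tensor_lift_pure. Qed.

Lemma tensor_map2_bilinear : bilinear_for *:%R *:%R tensor_map2.
Proof.
split=> [v c u w|u c v w] /=; first exact: (tensor_lift_linear (outer_bilin v)).
rewrite /tensor_map2; elim/tensor_ind: u => [x a||e p q IHp IHq].
- rewrite !(tensor_lift_pure (outer_bilin _)).
  exact: (tensor_lift_linear (inner_bilin x a)).
- have L0 v' : tensor_map2 0 v' = 0.
    have := tensor_lift_linear (outer_bilin v') (-1) 0 0.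
    by rewrite scaler0 addr0 scaleN1r addNr.
  by rewrite -!/(tensor_map2 _ _) !L0 scaler0 addr0.
- have LD v' := tensor_lift_linear (outer_bilin v') e p q.
  by rewrite !LD IHp IHq !scalerDr !scalerA mulrC addrACA.
Qed.

End TensorMap2.

Record lie_bracket (K : fieldType) (g : lmodType K) (br : g -> g -> g) : Prop :=
  LieBracket {
    lie_bilinear : bilinear_for *:%R *:%R br;
    lie_alternating : forall x, br x x = 0;
    lie_jacobi : forall x y z,
      br x (br y z) + br y (br z x) + br z (br x y) = 0 }.

Record lie_representation (K : fieldType) (g : lmodType K) (br : g -> g -> g)
    (V : vectType K) (tau : g -> 'End(V)) : Prop := LieRepresentation {
  lie_rep_linear : linear tau;
  lie_rep_bracket : forall x y,
    tau (br x y) = ((tau x \o tau y) - (tau y \o tau x))%VF }.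

(* T(g) as the free associative algebra on a basis X_0, ..., X_{n-1} of g. *)
Definition tensor_algebra (K : fieldType) (n : nat) := {malg K[{fmonom 'I_n}]}.

Section TensorAlgebra.
Variables (K : fieldType) (n : nat).
HB.instance Definition _ := GRing.Lalgebra.on (tensor_algebra K n).

Fact tensor_algebra_scalerAr (c : K) (x y : tensor_algebra K n) :
  c *: (x * y) = x * (c *: y).
Proof.
rewrite (malgMEw (fsubset_refl _) (msuppZ_le c y)) malgME scaler_sumr.
apply: eq_bigr => k1 _; rewrite scaler_sumr; apply: eq_bigr => k2 _.
by apply/malgP => k; rewrite mcoeffZ !mcoeffU mcoeffZ mulrnAr mulrCA.
Qed.
HB.instance Definition _ := GRing.Lalgebra_isAlgebra.Build K (tensor_algebra K n)
  tensor_algebra_scalerAr.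

End TensorAlgebra.

Section EnvelopingAlgebra.
Variables (K : fieldType) (g : vectType K) (br : g -> g -> g).
Variables (n : nat) (X : n.-tuple g) (t : K).

Definition to_tensor_algebra (x : g) : tensor_algebra K n :=
  \sum_(i < n) coord X i x *: (<< fmu i >> : tensor_algebra K n).

Inductive Ut_rel : tensor_algebra K n -> Prop :=
| Ut_rel_bracket x y : Ut_rel (to_tensor_algebra x * to_tensor_algebra y
    - to_tensor_algebra y * to_tensor_algebra x - t *: to_tensor_algebra (br x y)).

Definition Ut := aquot Ut_rel.
HB.instance Definition _ := GRing.PzRing.on Ut.
HB.instance Definition _ := GRing.Lmodule.on Ut.

Fact Ut_oner_neq0 : (1 : Ut) != 0.
Proof.
pose e : {rmorphism tensor_algebra K n -> K} := @mcoeff {fmonom 'I_n} K mone.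
have eT x : e (to_tensor_algebra x) = 0.
  rewrite raddf_sum big1 // => i _; rewrite /e /=.
  have ne : (fmu i == mone) = false.
    by apply/negP => /eqP /(congr1 (@fdeg _)); rewrite fdegU fdeg1.
  by rewrite mcoeffZ mcoeffU1 ne mulr0.
have eZ c u : e u = 0 -> e (c *: u) = 0 by rewrite /e /= mcoeffZ => ->; rewrite mulr0.
have eM u v : e u = 0 -> e (u * v) = 0 by rewrite rmorphM /= => ->; rewrite mul0r.
have eB u v : e u = 0 -> e v = 0 -> e (u - v) = 0.
  by rewrite rmorphB => -> ->; rewrite subrr.
apply/eqP => one0; have : e 1 = 0.
  apply: (@tsideal_rmorph K _ Ut_rel) => [u [x y]|].
    by apply: (eB); [apply: eB; apply: eM | apply: eZ]; apply: eT.
  by rewrite -[1]subr0; apply/apiP; rewrite raddf0.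
by rewrite rmorph1 => /eqP; rewrite oner_eq0.
Qed.
HB.instance Definition _ := GRing.PzSemiRing_isNonZero.Build Ut Ut_oner_neq0.
HB.instance Definition _ := GRing.Lmodule_isLalgebra.Build K Ut
  (@aquot_scalerAl K (tensor_algebra K n) Ut_rel).
HB.instance Definition _ := GRing.Lalgebra_isAlgebra.Build K Ut
  (@aquot_scalerAr K (tensor_algebra K n) Ut_rel).

Definition to_Ut (x : g) : Ut := api _ (to_tensor_algebra x).

Lemma to_Ut_bracket x y :
  to_Ut x * to_Ut y - to_Ut y * to_Ut x = t *: to_Ut (br x y).
Proof.
have scal u : t *: (api Ut_rel u : Ut) = api _ (t *: u) by exact/esym/apiZ.
have mul u v : (api Ut_rel u : Ut) * api _ v = api _ (u * v).
  exact/esym/apiM.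
have sub u v : (api Ut_rel u : Ut) - api _ v = api _ (u - v).
  exact/esym/(raddfB (api Ut_rel)).
rewrite /to_Ut scal; apply: etrans (congr2 (fun u v => u - v) (mul _ _) (mul _ _)) _.
by apply: etrans (sub _ _) _; apply/apiP/tsideal_sub.
Qed.

Lemma to_Ut_linear : linear to_Ut.
Proof.
move=> a x y; rewrite /to_Ut.
suff -> : to_tensor_algebra (a *: x + y) =
    a *: to_tensor_algebra x + to_tensor_algebra y by rewrite apiD apiZ.
rewrite scaler_sumr -big_split /=; apply: eq_bigr => i _.
by rewrite linearP scalerDl scalerA.
Qed.

End EnvelopingAlgebra.

From mathcomp Require Import mpoly.
(* multinomials also reserves this notation for polynomials over [cmonom]. *)
Local Notation "{ 'mpoly' K [ n ] }" := (mpoly.mpoly n K) : type_scope.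

Lemma linear_comb (K : fieldType) (U W : lmodType K) (f : U -> W) : linear f ->
  forall (J : finType) (c : J -> K) (y : J -> U),
    f (\sum_j c j *: y j) = \sum_j c j *: f (y j).
Proof.
move=> fl J c y; elim/big_rec2: _ => [|j u v _ <-]; last by rewrite fl.
by have := fl (-1) 0 0; rewrite scaler0 addr0 scaleN1r addNr.
Qed.

Section StarProduct.
Variables (K : fieldType) (g : vectType K) (br : g -> g -> g).
Variables (n : nat) (X : n.-tuple g).

Definition to_S (x : g) : {mpoly K[n]} := \sum_(i < n) coord X i x *: 'X_i.

(* c^k_ij *)
Definition struct_const (i j k : 'I_n) : K :=
  coord X k (br (tnth X i) (tnth X j)).

Definition poisson (a b : {mpoly K[n]}) : {mpoly K[n]} :=
  \sum_(i < n) \sum_(j < n) \sum_(k < n)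
    struct_const i j k *: ('X_k * a^`M(i) * b^`M(j)).

Lemma poisson_bilinear : bilinear_for *:%R *:%R poisson.
Proof.
split=> [b c x y|a c x y] /=.
  rewrite /poisson scaler_sumr -big_split; apply: eq_bigr => i _.
  rewrite scaler_sumr -big_split; apply: eq_bigr => j _.
  rewrite scaler_sumr -big_split; apply: eq_bigr => k _ /=.
  rewrite linearP mulrDr mulrDl scalerDr -scalerAr -scalerAl.
  by rewrite !scalerA mulrC.
rewrite /poisson scaler_sumr -big_split; apply: eq_bigr => i _.
rewrite scaler_sumr -big_split; apply: eq_bigr => j _.
rewrite scaler_sumr -big_split; apply: eq_bigr => k _ /=.
by rewrite linearP mulrDr scalerDr -scalerAr !scalerA mulrC.
Qed.

Definition symmetrization (A : algType K) (k : nat) (Y : 'I_k -> A) : A :=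
  (k`!%:R)^-1 *: \sum_(s : 'S_k) \prod_(i < k) Y (s i).

Lemma symmetrization_perm (A : algType K) (k k' : nat) (I : eqType)
    (w : 'I_k -> I) (w' : 'I_k' -> I) (x : I -> A) :
    perm_eq (codom w) (codom w') ->
  symmetrization (fun i => x (w i)) = symmetrization (fun i => x (w' i)).
Proof.
move=> pw; have ek := perm_size pw; rewrite !size_codom !card_ord in ek.
case: k' / ek w' pw => w' pw.
have /tuple_permP [p ep] : perm_eq (mktuple w) (mktuple w') by [].
have wE i : w i = w' (p i).
  rewrite -(tnth_mktuple w) -(tnth_mktuple w').
  rewrite -[RHS](tnth_mktuple (fun j => tnth (mktuple w') (p j))).
  by congr tnth; apply: val_inj.
rewrite /symmetrization; congr (_ *: _).
rewrite [RHS](reindex_inj (mulIg p)) /=; apply: eq_bigr => s _.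
by apply: eq_bigr => i _; rewrite wE permM.
Qed.

Lemma symmetrization_sum (A : algType K) (k l : nat) (c : 'I_k -> 'I_l -> K)
    (x : 'I_l -> A) :
  symmetrization (fun i => \sum_j c i j *: x j) =
  \sum_(f : {ffun 'I_k -> 'I_l})
    (\prod_i c i (f i)) *: symmetrization (fun i => x (f i)).
Proof.
rewrite /symmetrization scaler_sumr.
under eq_bigr => s _.
  rewrite bigA_distr_bigA /=.
  rewrite (reindex_onto (fun f : {ffun 'I_k -> 'I_l} => [ffun i => f (s i)])
    (fun f => [ffun i => f ((s^-1)%g i)])) /=; last first.
    by move=> f _; apply/ffunP => i; rewrite !ffunE permK.
  under eq_bigl => f.
    rewrite (_ : _ == f); last by apply/eqP/ffunP => i; rewrite !ffunE permKV.
    over.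
  under eq_bigr => f _.
    under eq_bigr => i _ do rewrite ffunE.
    rewrite scaler_prod -(reindex_inj (P := xpredT) (F := fun i => c i (f i))
      (@perm_inj _ s)) /=.
    over.
  over.
rewrite -scaler_sumr exchange_big scaler_sumr /=; apply: eq_bigr => f _.
by rewrite -scaler_sumr !scalerA mulrC.
Qed.

Section PBW.
Variable t : K.

(* [m2s m] lists the indices of the variables of the monomial m, with
   multiplicities; the resulting formula for a product of arbitrary elements
   of g is [I_PBW_prod]. *)
Definition I_PBW (p : {mpoly K[n]}) : Ut br X t :=
  \sum_(m <- msupp p) p@_m *:
    symmetrization (fun i => to_Ut br X t (tnth X (tnth (in_tuple (m2s m)) i))).

Lemma I_PBW_linear : linear I_PBW.
Proof.
move=> c p q; pose F (m : 'X_{1..n}) : Ut br X t :=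
  symmetrization (fun i => to_Ut br X t (tnth X (tnth (in_tuple (m2s m)) i))).
have IE i r : (msize r <= i)%N -> I_PBW r = \sum_(m : 'X_{1..n < i}) r@_m *: F m.
  move=> le_ri; set I : subFinType _ := 'X_{1..n < i}.
  rewrite /I_PBW (ssrcomplements.big_mksub I) ?msupp_uniq //=; first last.
    by move=> x /msize_mdeg_lt /leq_trans; apply.
  by rewrite big_rmcond //= => j /memN_msupp_eq0 ->; rewrite scale0r.
pose i := maxn (msize (c *: p + q)) (maxn (msize p) (msize q)).
rewrite !(IE i) ?leq_max ?leqnn ?orbT // scaler_sumr -big_split.
by apply: eq_bigr => m _ /=; rewrite mcoeffD mcoeffZ scalerDl -scalerA.

Qed.

Hypothesis X_basis : basis_of fullv X.

Lemma I_PBW_prod k (Y : 'I_k -> g) :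
  I_PBW (\prod_(i < k) to_S (Y i)) =
  symmetrization (fun i => to_Ut br X t (Y i)).
Proof.
pose x j := to_Ut br X t (tnth X j).
have UE y : to_Ut br X t y = \sum_j coord X j y *: x j.
  rewrite {1}(coord_basis X_basis (memvf y)) (linear_comb (@to_Ut_linear _ _ _ _ _ _)).
  by apply: eq_bigr => j _; rewrite /x (tnth_nth 0).
transitivity (symmetrization (fun i => \sum_j coord X j (Y i) *: x j)); last first.
  rewrite /symmetrization; congr (_ *: _); apply: eq_bigr => s _.
  by apply: eq_bigr => i _; rewrite -UE.
rewrite symmetrization_sum bigA_distr_bigA /=.
under eq_bigr => f _ do rewrite scaler_prod.
rewrite (linear_comb I_PBW_linear); apply: eq_bigr => f _; congr (_ *: _).
rewrite mprodXE /I_PBW msuppX big_seq1 mcoeffX eqxx scale1r.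
apply: (@symmetrization_perm _ _ _ _ _ _ x).
apply/allP => j _ /=; set m := (\sum_i _)%MM.
have -> : codom (tnth (in_tuple (m2s m))) = m2s m by exact: (map_tnth_enum (in_tuple (m2s _))).
have -> : count_mem j (m2s m) = m j.
  by rewrite -{2}(s2mK m) mnmE.
rewrite /m mnm_sumE /codom /image_mem count_map -sum1_count.
rewrite big_enum_cond [X in _ == X]big_mkcond /=; apply/eqP.
by apply: eq_bigr => i _; rewrite mnm1E; case: (f i == j).
Qed.

End PBW.

Section TauValued.
Variable V : vectType K.

Definition C_tau := tensor 'End(V) {mpoly K[n]}.
Definition Q_tau (t : K) := tensor 'End(V) (Ut br X t).

Definition C_tau_mul : C_tau -> C_tau -> C_tau :=
  tensor_map2 (@comp_lfun K V V V) *%R.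
Definition Q_tau_mul (t : K) : Q_tau t -> Q_tau t -> Q_tau t :=
  tensor_map2 (@comp_lfun K V V V) *%R.
Definition nc_poisson : C_tau -> C_tau -> C_tau :=
  tensor_map2 (@comp_lfun K V V V) poisson.

Definition F_PBW (t : K) (u : C_tau) : Q_tau t :=
  tensor_lift (fun A a => tpure A (I_PBW t a)) u.

(* By the PBW theorem F_PBW t is bijective (K of characteristic 0, br a Lie
   bracket, X a basis), so that the preimage selected here is the only one. *)
Definition F_PBW_inv (t : K) (v : Q_tau t) : C_tau :=
  xget 0 [set u | F_PBW t u = v]%classic.

Definition star (t : K) (u v : C_tau) : C_tau :=
  F_PBW_inv (Q_tau_mul (F_PBW t u) (F_PBW t v)).

Lemma comp_lfun_bilinear : bilinear_for *:%R *:%R (@comp_lfun K V V V).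
Proof.
split=> [h c f f'|f c h h'] /=.
  by rewrite comp_lfunDl comp_lfunZl.
by rewrite comp_lfunDr comp_lfunZr.
Qed.

Lemma algebra_mul_bilinear (A : algType K) :
  bilinear_for *:%R *:%R (@GRing.mul A).
Proof.
split=> [x c y z|x c y z] /=; first by rewrite mulrDl scalerAl.
by rewrite mulrDr scalerAr.
Qed.

Lemma C_tau_mul_pure (A B : 'End(V)) (a b : {mpoly K[n]}) :
  C_tau_mul (tpure A a) (tpure B b) = tpure (A \o B)%VF (a * b).
Proof.
exact: tensor_map2_pure comp_lfun_bilinear (@algebra_mul_bilinear _) _ _ _ _.
Qed.

Lemma Q_tau_mul_pure (t : K) (A B : 'End(V)) (a b : Ut br X t) :
  Q_tau_mul (tpure A a) (tpure B b) = tpure (A \o B)%VF (a * b).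
Proof.
exact: tensor_map2_pure comp_lfun_bilinear (@algebra_mul_bilinear _) _ _ _ _.
Qed.

Lemma nc_poisson_pure (A B : 'End(V)) (a b : {mpoly K[n]}) :
  nc_poisson (tpure A a) (tpure B b) = tpure (A \o B)%VF (poisson a b).
Proof. exact: tensor_map2_pure comp_lfun_bilinear poisson_bilinear _ _ _ _. Qed.

Lemma F_PBW_pure (t : K) (A : 'End(V)) (a : {mpoly K[n]}) :
  F_PBW t (tpure A a) = tpure A (I_PBW t a).
Proof.
have [pl pr] := @tpure_bilinear K 'End(V) (Ut br X t).
apply: tensor_lift_pure; split=> [b c f h|f c b d] /=; first exact: pl.
by rewrite I_PBW_linear; exact: pr.
Qed.

End TauValued.
End StarProduct.

(* Main.v *)
From HB Require Import structures.
Require Import Defs.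
From mathcomp Require Import all_boot all_order all_algebra all_fingroup.
From mathcomp Require Import ring sesquilinear complex boolp classical_sets.
From mathcomp Require Import reals finmap monalg mpoly.

(** Write [S] for the symmetric algebra, [I : S -> U_t] for symmetrization and
    [e_x] for the generators of [U_t].  On pure tensors the star product is
    [AB (x) L (I a * I b)], where [L] is the inverse of [I]; so the theorem needs
    [I] to be bijective for every [t] and the value of [L (I a * I b)] up to
    order [t^2].  Both come from one explicit module structure on [S].

    Left multiplication by an element [x] of [g], transported to [S] by
    symmetrization, is the operator
      [rho_x p = sum_m phi_m t^m [e_i1, [.., [e_im, x]]] d^i1 .. d^im p],
    where [phi(u) = u / (e^u - 1)] has the coefficients [bern].  It is [bernop]
    applied to [x (x) p].  To get [[rho_x, rho_z] = t rho_[x,z]]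
    ([bernop_comm]), let [a] and [b] be the operations [sum_i [e_i, _] d^i] on
    the first and on the second factor of [g (x) g (x) S].  They commute, and by
    the Jacobi identity the claim becomes the identity
      [phi(a) (phi(a+b) - phi(b)) / a + phi(b) (phi(a+b) - phi(a)) / b
       + phi(a+b) = 0],
    which is [e^(a+b) = e^a e^b] with its denominators cleared
    ([bern_identity]).  So [S] is a [U_t]-module, and [L u = u . 1] is defined
    on [U_t].

    The link with [I] is the Euler operator [Eu p = sum_i X_i d^i p], which
    multiplies a homogeneous polynomial of degree [k] by [k].  Splitting off the
    first factor of a symmetrized product gives [I (Eu p) = sum_i e_i I (d^i p)]
    ([I_PBW_euler]), and in characteristic 0 a statement about all [p] may be
    proved by passing from the [d^i p] to [Eu p] ([euler_ind]).  The terms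
    [m > 0] of [sum_i rho_(e_i) (d^i p)] pair an antisymmetric bracket with a
    symmetric second derivative, so they vanish, whence [L (I p) = p]
    ([I_PBWK]).  Surjectivity of [I] is an induction on the degree
    ([filt_mul]).

    Since [L (e_x u) = rho_x (L u)], the same induction computes
    [L (I a * I b)]: as [rho_x q = x q + t/2 {x, q} + O(t^2)], it is
    [a b + t/2 {a, b} + O(t^2)] because [{_, _}] satisfies the matching
    recursion [poisson_euler]. *)

Set Implicit Arguments.
Unset Strict Implicit.
Unset Printing Implicit Defensive.

Import GRing.Theory.
Local Open Scope ring_scope.
Local Notation "{ 'mpoly' K [ n ] }" := (mpoly.mpoly n K) : type_scope.

Lemma linear_fun0 (K : pzRingType) (U W : lmodType K) (f : U -> W) :
  linear f -> f 0 = 0.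
Proof. by move/(_ (-1) 0 0); rewrite scaler0 addr0 scaleN1r addNr. Qed.

Lemma linear_fun_sum (K : pzRingType) (U W : lmodType K) (f : U -> W)
    (J : finType) (u : J -> U) : linear f -> f (\sum_j u j) = \sum_j f (u j).
Proof.
move=> fl; elim/big_rec2: _ => [|j v w _ <-]; first exact: linear_fun0.
by have := fl 1 (u j) w; rewrite !scale1r.
Qed.

Lemma transport_bilinear (K : fieldType) (U W : lmodType K) (f : U -> W) (h : W -> U)
    (m : W -> W -> W) :
    linear f -> linear h -> bilinear_for *:%R *:%R m ->
  bilinear_for *:%R *:%R (fun u v => h (m (f u) (f v))).
Proof.
move=> fl hl [ml mr]; split=> [v c u u'|u c v v'] /=; rewrite fl -hl; congr h.
  exact: ml.
exact: mr.
Qed.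

Lemma sub_eq_addl (V : zmodType) (x y z : V) : x - y = z -> x = y + z.
Proof. by move=> <-; rewrite addrC subrK. Qed.

(** * Modules over the enveloping algebra *)

Section MalgLift.
Variables (K : fieldType) (G : choiceType) (W : lmodType K).

Definition malg_lift (F : G -> W) (u : {malg K[G]}) : W :=
  \sum_(k <- monalg.msupp u) monalg.mcoeff k u *: F k.

Lemma malg_lift_linear F : linear (malg_lift F).
Proof.
have E (d : {fset G}) u : (monalg.msupp u `<=` d)%fset ->
    malg_lift F u = \sum_(k <- d) monalg.mcoeff k u *: F k.
  move=> le; rewrite /malg_lift (big_fset_incl _ le) // => x _ /monalg.mcoeff_outdom ->.
  by rewrite scale0r.
move=> c u v.
pose d := (monalg.msupp u `|` monalg.msupp v `|` monalg.msupp (c *: u + v))%fset.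
have du : (monalg.msupp u `<=` d)%fset by rewrite /d -fsetUA fsubsetUl.
have dv : (monalg.msupp v `<=` d)%fset by rewrite /d fsetUAC fsubsetUr.
rewrite (E d) ?fsubsetUr // (E d u du) (E d v dv) scaler_sumr -big_split /=.
by apply: eq_bigr => k _; rewrite monalg.mcoeffD monalg.mcoeffZ scalerDl scalerA.
Qed.
HB.instance Definition _ F := GRing.isLinear.Build K {malg K[G]} W _
  (malg_lift F) (malg_lift_linear F).

Lemma malg_liftU F k : malg_lift F << k >> = F k.
Proof.
by rewrite /malg_lift monalg.msuppU oner_eq0 big_seq_fset1 monalg.mcoeffUU scale1r.
Qed.

Lemma malg_linear_ind (P : {malg K[G]} -> Prop) :
    P 0 -> (forall k, P << k >>) -> (forall c u v, P u -> P v -> P (c *: u + v)) ->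
  forall u, P u.
Proof.
move=> P0 PU PD u; rewrite [u]monalgE; apply: big_ind => // [v w Pv Pw|k _].
  by rewrite -[v]scale1r; apply: PD.
have -> : << monalg.mcoeff k u *g k >> = monalg.mcoeff k u *: << k >> + 0.
  by apply/malgP => j; rewrite addr0 monalg.mcoeffZ !monalg.mcoeffU mulr_natr.
exact: PD.
Qed.

End MalgLift.

Section FreeAction.
Variables (K : fieldType) (n : nat) (W : lmodType K).
Variables (rho : 'I_n -> {linear W -> W}) (w0 : W).
Local Notation T := (tensor_algebra K n).
Local Notation var i := (<< fmu i >> : T).

Lemma tensor_algebra_ind (P : T -> Prop) :
    P 0 -> (forall k : {fmonom 'I_n}, P << k >>) ->
    (forall c (u v : T), P u -> P v -> P (c *: u + v)) ->
  forall u, P u.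
Proof. exact: malg_linear_ind. Qed.

(** The action of the free algebra on the vector [w0], with generators acting by
    [rho]. *)
Definition free_act : T -> W :=
  malg_lift (fun m : {fmonom 'I_n} => foldr (fun i w => rho i w) w0 m).

Lemma free_act_linear : linear free_act.
Proof. exact: malg_lift_linear. Qed.
HB.instance Definition _ := GRing.isLinear.Build K T W _ free_act free_act_linear.

Lemma free_actZ c u : free_act (c *: u) = c *: free_act u.
Proof. exact: linearZ. Qed.

Lemma free_actB u v : free_act (u - v) = free_act u - free_act v.
Proof. exact: linearB. Qed.

Lemma free_act1 : free_act 1 = w0.
Proof. by rewrite /free_act malg_liftU fm1. Qed.

Lemma malgU_fmM (m m' : {fmonom 'I_n}) :
  (<< m >> : T) * << m' >> = << mmul m m' >>.
Proof. by rewrite [LHS]fgmulUU mulr1. Qed.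

Lemma free_actX i u : free_act (var i * u) = rho i (free_act u).
Proof.
elim/tensor_algebra_ind: u => [|m|c u v IHu IHv]; first by rewrite mulr0 !linear0.
  by rewrite malgU_fmM /free_act !malg_liftU fmM fmU.
have -> : var i * (c *: u + v) = c *: (var i * u) + var i * v.
  by rewrite mulrDr scalerAr.
rewrite !free_act_linear linearP.
congr (_ *: _ + _); [exact: IHu | exact: IHv].
Qed.

(** The annihilator of [w0] is a left ideal.  With [rep] below this makes it
    contain the two-sided ideal that defines [U_t]. *)
Lemma free_act_ideal a u : free_act u = 0 -> free_act (a * u) = 0.
Proof.
move=> hu; elim/tensor_algebra_ind: a => [|[s]|c a b IHa IHb].
- by rewrite mul0r linear0.
- elim: s => [|i s IH].
    suff -> : (<< FMonom [::] >> : T) = 1 by rewrite mul1r.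
    by congr << _ >>; apply: val_inj; rewrite /= fm1.
  have -> : (<< FMonom (i :: s) >> : T) = var i * << FMonom s >>.
    rewrite malgU_fmM; congr << _ >>; apply: val_inj; by rewrite /= fmM fmU.
  by rewrite -mulrA free_actX IH linear0.
have e : (c *: a + b) * u = c *: (a * u) + b * u by rewrite mulrDl scalerAl.
rewrite (congr1 free_act e).
rewrite free_act_linear -[RHS](addr0 0) -{1}(scaler0 _ c).
congr (_ *: _ + _); [exact: IHa | exact: IHb].
Qed.

Variables (g : vectType K) (br : g -> g -> g) (X : n.-tuple g) (t : K).

Definition lin_act (x : g) (w : W) : W := \sum_(i < n) coord X i x *: rho i w.

Lemma free_act_to x u :
  free_act (to_tensor_algebra X x * u) = lin_act x (free_act u).
Proof.
rewrite mulr_suml linear_sum; apply: eq_bigr => i _.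
by rewrite -scalerAl linearZ /= free_actX.
Qed.

Hypothesis rep : forall x y w,
  lin_act x (lin_act y w) - lin_act y (lin_act x w) = t *: lin_act (br x y) w.

(** In [a * r * b] the relation [r] acts on [b . w0], where it vanishes by
    [rep]. *)
Lemma free_act_tsideal u : tsideal (Ut_rel br X t) u -> free_act u = 0.
Proof.
elim=> [|a _ b v [x y] _ IH]; first exact: linear0.
rewrite linearD /= IH addr0 -mulrA; apply: free_act_ideal.
have e (p q r : T) : (p * q - q * p - t *: r) * b
    = p * (q * b) - q * (p * b) - t *: (r * b).
  by rewrite !mulrBl -scalerAl !mulrA.
apply: etrans (congr1 free_act (e _ _ _)) _.
have E x1 y1 : free_act (to_tensor_algebra X x1 * (to_tensor_algebra X y1 * b))
    = lin_act x1 (lin_act y1 (free_act b)).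
  exact: etrans (free_act_to _ _) (congr1 _ (free_act_to _ _)).
rewrite free_actB free_actB free_actZ; apply/eqP; rewrite subr_eq0; apply/eqP.
apply: etrans (congr2 (fun p q => p - q) (E x y) (E y x)) _; rewrite rep.
exact: congr1 (esym (free_act_to _ _)).
Qed.

(** The map [u |-> u . w0] for the [U_t]-module given by [rho]. *)
Definition Ut_act (u : Ut br X t) : W := free_act (arepr u).

Lemma Ut_act_api u : Ut_act (api _ u) = free_act u.
Proof.
apply/eqP; rewrite -subr_eq0 -linearB; apply/eqP/free_act_tsideal.
exact: api_arepr.
Qed.

Lemma Ut_act_linear : linear Ut_act.
Proof.
move=> c u v; rewrite -[u]areprK -[v]areprK !Ut_act_api -free_act_linear.
rewrite -Ut_act_api; congr Ut_act; exact: esym (api_is_linear _ _ _ _).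
Qed.

Lemma Ut_act1 : Ut_act 1 = w0.
Proof. by rewrite -free_act1 -Ut_act_api. Qed.

Lemma Ut_act_to x (u : Ut br X t) : Ut_act (to_Ut br X t x * u) = lin_act x (Ut_act u).
Proof.
by rewrite -[u]areprK /to_Ut -[_ * _](rmorphM (api _)) !Ut_act_api free_act_to.
Qed.

End FreeAction.

(** * Bernoulli coefficients and the exponential law *)

Section Bernoulli.
Variable K : fieldType.

(** The first [k] coefficients of [u / (e^u - 1)], from the recursion
    expressing that its product with [(e^u - 1) / u] is 1; as a list, because
    each of them depends on all the previous ones. *)
Fixpoint bern_seq (k : nat) : seq K :=
  if k is k'.+1 then
    let s := bern_seq k' in
    rcons s ((k' == 0)%:R - \sum_(i < k') s`_i / ((k' - i).+1)`!%:R)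
  else [::].

(** The Bernoulli number [B_k] divided by [k!]. *)
Definition bern (k : nat) : K := (bern_seq k.+1)`_k.

Lemma size_bern_seq k : size (bern_seq k) = k.
Proof. by elim: k => //= k IH; rewrite size_rcons IH. Qed.

Lemma nth_bern_seq k i : (i < k)%N -> (bern_seq k)`_i = bern i.
Proof.
elim: k => // k IH; rewrite ltnS leq_eqVlt => /orP[/eqP -> //|lt_ik].
by rewrite /= nth_rcons size_bern_seq lt_ik IH.
Qed.

Lemma bernE k :
  bern k = (k == 0)%:R - \sum_(i < k) bern i / ((k - i).+1)`!%:R.
Proof.
rewrite {1}/bern /= nth_rcons size_bern_seq ltnn eqxx; congr (_ - _).
by apply: eq_bigr => i _; rewrite nth_bern_seq.
Qed.

Lemma bern_rec k :
  \sum_(i < k.+1) bern i / ((k - i).+1)`!%:R = (k == 0)%:R.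
Proof. by rewrite big_ord_recr /= subnn divr1 [bern k]bernE addrC subrK. Qed.

Lemma bern0 : bern 0 = 1.
Proof. by rewrite bernE big_ord0 subr0. Qed.

Lemma bern1 : bern 1 = - 2^-1.
Proof. by rewrite bernE big_ord1 bern0 sub0r mul1r. Qed.

Definition bern_poly M : {poly K} := \poly_(i < M) bern i.
(** The truncation of [(e^u - 1) / u]. *)
Definition dexp_poly M : {poly K} := \poly_(i < M) (i.+1`!%:R)^-1.

Lemma bern_dexp_poly M :
  exists r, bern_poly M * dexp_poly M = 1 + r * 'X^M.
Proof.
set p := _ * _; exists (drop_poly M (p - 1)).
rewrite -[LHS](subrK 1) addrC; congr (_ + _).
rewrite -[LHS](poly_take_drop M) [take_poly _ _](_ : _ = 0) ?add0r //.
apply/polyP => k; rewrite coef_take_poly coef0; case: ltnP => // lt_kM.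
apply/eqP; rewrite coefB coef1 -bern_rec subr_eq0 coefM; apply/eqP.
apply: eq_bigr => i _; rewrite !coef_poly (leq_ltn_trans (leq_subr _ _) lt_kM).
have -> : (i < M)%N by apply: leq_ltn_trans lt_kM; rewrite -ltnS.
by [].
Qed.

Definition series_in (A : algType K) M (p : nat -> K) (c : A) : A :=
  \sum_(i < M) p i *: c ^+ i.

Lemma series_in_horner (A : algType K) M (p : nat -> K) (c : A) :
  series_in M p c = horner_alg c (\poly_(i < M) p i).
Proof.
rewrite poly_def linear_sum; apply: eq_bigr => i _.
by rewrite linearZ rmorphXn /= horner_algX mulr_algl.
Qed.

End Bernoulli.

Section Order.
Variables (K : fieldType) (n : nat).
Implicit Types f g : {mpoly K[n]}.

(** Power series in two variables are replaced by polynomials modulo those of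
    order at least [N]: a congruence [f = g] is [ord_ge N (f - g)]. *)
Definition ord_ge N f := forall m, (mdeg m < N)%N -> f@_m = 0.

Lemma ord_ge0 N : ord_ge N 0.
Proof. by move=> m _; rewrite mcoeff0. Qed.

Lemma ord_geD N f g : ord_ge N f -> ord_ge N g -> ord_ge N (f + g).
Proof. by move=> hf hg m lt_m; rewrite mcoeffD hf ?hg ?addr0. Qed.

Lemma ord_geN N f : ord_ge N f -> ord_ge N (- f).
Proof. by move=> hf m lt_m; rewrite mcoeffN hf ?oppr0. Qed.

Lemma ord_geB N f g : ord_ge N f -> ord_ge N g -> ord_ge N (f - g).
Proof. by move=> hf hg; apply/ord_geD/ord_geN. Qed.

Lemma ord_geZ N c f : ord_ge N f -> ord_ge N (c *: f).
Proof. by move=> hf m lt_m; rewrite mcoeffZ hf ?mulr0. Qed.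

Lemma ord_ge_sum N (I : Type) (r : seq I) (P : pred I) (F : I -> {mpoly K[n]}) :
  (forall i, P i -> ord_ge N (F i)) -> ord_ge N (\sum_(i <- r | P i) F i).
Proof.
by move=> hF; apply: big_ind => //; [exact: ord_ge0 | exact: ord_geD].
Qed.

Lemma ord_geM p q f g : ord_ge p f -> ord_ge q g -> ord_ge (p + q) (f * g).
Proof.
move=> hf hg m lt_m; rewrite mcoeffM big1 // => -[k1 k2] /= /eqP ek.
have [lt1|le1] := ltnP (mdeg k1) p; first by rewrite hf ?mul0r.
have [lt2|le2] := ltnP (mdeg k2) q; first by rewrite hg ?mulr0.
suff : (p + q <= mdeg m)%N by rewrite leqNgt lt_m.
by rewrite (congr1 mdeg ek) mdegD leq_add.
Qed.

Lemma ord_geMr p f g : ord_ge p f -> ord_ge p (f * g).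
Proof. by move=> hf; rewrite -[p]addn0; apply: ord_geM. Qed.

Lemma ord_geMl p f g : ord_ge p g -> ord_ge p (f * g).
Proof. by rewrite mulrC; exact: ord_geMr. Qed.

Lemma ord_geM1 N f g h : ord_ge 1 f -> ord_ge N g -> ord_ge N.+1 (f * h * g).
Proof. by move=> hf hg; apply: (@ord_geM 1 N) => //; apply: ord_geMr. Qed.

Lemma ord_geX f k : ord_ge 1 f -> ord_ge k (f ^+ k).
Proof.
by move=> hf; elim: k => // k IH; rewrite exprS -add1n; apply: ord_geM.
Qed.

Lemma ord_ge_var i : ord_ge 1 ('X_i : {mpoly K[n]}).
Proof.
move=> m; rewrite mcoeffX; case: eqP => // <-; by rewrite mdeg1.
Qed.

(** This replaces the division by a variable in a ring of power series. *)
Lemma ord_ge_varM i N f : ord_ge N.+1 ('X_i * f) -> ord_ge N f.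
Proof.
move=> h m lt_m; have := h (U_(i) + m)%MM.
by rewrite [_ * f]mulrC mcoeffMX mdegD mdeg1 add1n ltnS; apply.
Qed.

Lemma ord_geW p q f : (q <= p)%N -> ord_ge p f -> ord_ge q f.
Proof. by move=> le_qp hf m lt_m; apply: hf; apply: leq_trans le_qp. Qed.

End Order.

Section DividedDifference.
Variable A : comPzRingType.

(** The divided difference [(u^m - v^m) / (u - v)], in the recursive form in
    which it arises from iterating an operator in [iter_delta_mul]. *)
Fixpoint pow_divdiff (m : nat) (u v : A) : A :=
  if m is m'.+1 then u * pow_divdiff m' u v + v ^+ m' else 0.

Lemma pow_divdiffP m u v : (u - v) * pow_divdiff m u v = u ^+ m - v ^+ m.
Proof.
elim: m => [|m IH] /=; first by rewrite mulr0 subrr.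
rewrite mulrDr mulrCA IH !exprS; ring.
Qed.

(** Here [fa], [fb], [fs] stand for the values of [phi] at [a], [b], [a + b] and
    [da], [db] for its divided differences; the identity of [bern_identity] is
    multiplied by [a b] so that only values of [phi] remain. *)
Lemma bern_cross_multiplied (a b fa fb fs da db : A) :
    b * da = fs - fa -> a * db = fs - fb ->
  a * (b * (db * fa + da * fb + fs))
  = fs * (b * fa + a * fb + a * b) - (a + b) * fa * fb.
Proof.
move=> ea eb; transitivity (b * fa * (a * db) + a * fb * (b * da) + a * b * fs).
  ring.
rewrite ea eb; ring.
Qed.

(** With [xa], [xb], [xs] the values of [(e^u - 1) / u], the right-hand side
    shows the cross-multiplied identity as a combination of the error in
    [e^a e^b = e^(a+b)] and of the errors in [fa xa = 1] and its analogues, the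
    latter always multiplied by an element of order 1. *)
Lemma exp_cross_multiplied (a b fa fb fs xa xb xs : A) :
  fs * (b * fa + a * fb + a * b) - (a + b) * fa * fb
  = fa * fb * fs * ((1 + a * xa) * (1 + b * xb) - (1 + (a + b) * xs))
    - a * (fb * fs) * (fa * xa - 1) - b * (fa * fs) * (fb * xb - 1)
    - a * (b * fs) * ((fa * xa - 1) + (fb * xb - 1)
                      + (fa * xa - 1) * (fb * xb - 1))
    + (a + b) * (fa * fb) * (fs * xs - 1).
Proof. ring. Qed.

End DividedDifference.

Section TwoVariables.
Variable K : fieldType.
Hypothesis charK : [pchar K] =i pred0.
Local Notation P2 := {mpoly K[2]}.

Lemma natr_fact_neq0 m : (m`!)%:R != 0 :> K.
Proof. by rewrite ((pcharf0P K).1 charK) -lt0n fact_gt0. Qed.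

Lemma bern_dexp M (c : P2) : ord_ge 1 c ->
  ord_ge M (series_in M (bern K) c
            * series_in M (fun i => (i.+1`!%:R)^-1) c - 1).
Proof.
move=> hc; have [r er] := bern_dexp_poly K M.
rewrite !series_in_horner -/(bern_poly K M) -/(dexp_poly K M) -rmorphM er.
rewrite rmorphD rmorph1 rmorphM rmorphXn /= horner_algX addrC addKr.
by apply/ord_geMl/ord_geX.
Qed.

(** Both sides are sums of [a^i b^j / (i! j!)], over the square [i, j < M] and
    over the triangle [i + j < M]; the terms outside the triangle have order at
    least [M]. *)
Lemma exp_add M (a b : P2) : ord_ge 1 a -> ord_ge 1 b ->
  let E := series_in M (fun i => (i`!%:R)^-1) in
  ord_ge M (E a * E b - E (a + b)).
Proof.
move=> ha hb E.
pose F i j : P2 := ((i`!%:R)^-1 * (j`!%:R)^-1) *: (a ^+ i * b ^+ j).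
have EM : E a * E b = \sum_(0 <= i < M) \sum_(0 <= j < M) F i j.
  rewrite big_mkord /E /series_in mulr_suml; apply: eq_bigr => i _.
  rewrite big_mkord mulr_sumr; apply: eq_bigr => j _.
  by rewrite -scalerAl -scalerAr scalerA.
have ED : E (a + b) = \sum_(0 <= i < M) \sum_(0 <= j < M - i) F i j.
  transitivity (\sum_(0 <= k < M) \sum_(0 <= i < M | (i <= k)%N) F i (k - i)%N).
    rewrite /E /series_in big_mkord; apply: eq_bigr => k _.
    rewrite exprDn scaler_sumr.
    rewrite (reindex_inj rev_ord_inj) /=.
    rewrite -(big_mkord xpredT (fun i => (k`!%:R)^-1 *: (a ^+ (k - (k.+1 - i.+1))
       * b ^+ (k.+1 - i.+1) *+ 'C(k, k.+1 - i.+1)))).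
    rewrite (big_nat_widen _ _ M) //; apply: eq_big => // i; rewrite ltnS => le_ik.
    rewrite subSS subKn // bin_sub // /F -scaler_nat scalerA.
    congr (_ *: _); apply: (mulfI (natr_fact_neq0 k)).
    rewrite mulVKf ?natr_fact_neq0 //.
    rewrite -(bin_fact le_ik) !natrM.
    have := natr_fact_neq0 i; have := natr_fact_neq0 (k - i); move=> h1 h2; field.
    by rewrite h1 h2.
  rewrite (exchange_big_dep_nat predT) //=; apply: eq_big_nat => i /andP[_ lt_iM].
  rewrite -(big_nat_widenl i 0 M xpredT (fun k => F i (k - i)%N)) //.
  rewrite -{1}(add0n i) big_addn; apply: eq_bigr => j _; by rewrite addnK.
rewrite EM ED -sumrB; apply: ord_ge_sum => i _.
rewrite (@big_cat_nat _ _ _ (M - i) 0 M) ?leq_subr //= addrAC subrr add0r.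
rewrite big_nat; apply: ord_ge_sum => j /andP[le_j _]; apply: ord_geZ.
apply: (@ord_geW _ _ (i + j)); first by rewrite -leq_subLR.
by apply: ord_geM; apply: ord_geX.
Qed.

Definition bern_divdiff M (u v : P2) : P2 :=
  \sum_(m < M) bern K m *: pow_divdiff m u v.

Lemma bern_divdiffP M u v : (u - v) * bern_divdiff M u v =
  series_in M (bern K) u - series_in M (bern K) v.
Proof.
rewrite mulr_sumr -sumrB; apply: eq_bigr => m _.
by rewrite -scalerAr pow_divdiffP scalerBr.
Qed.

(** The functional equation of [phi(u) = u / (e^u - 1)] that the commutation of
    the operators [rho_x] amounts to.  Multiplied by [a b] it follows from
    [e^(a+b) = e^a e^b] up to order [M.+1]; cancelling [a] and [b] costs two
    orders. *)
Lemma bern_identity M (a := 'X_ord0 : P2) (b := 'X_ord_max : P2) :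
  let Phi := series_in M (bern K) in
  ord_ge M.-1 (bern_divdiff M (a + b) b * Phi a + bern_divdiff M (a + b) a * Phi b
               + Phi (a + b)).
Proof.
move=> Phi; set Z := (Z in ord_ge _ Z).
have [ha hb] : ord_ge 1 a /\ ord_ge 1 b by split; apply: ord_ge_var.
have hs : ord_ge 1 (a + b) by apply: ord_geD.
case: M @Phi @Z => // M Phi Z /=.
apply: (@ord_ge_varM _ _ ord_max); apply: (@ord_ge_varM _ _ ord0).
rewrite -/a -/b.
pose Psi (c : P2) := series_in M.+1 (fun i => (i.+1`!%:R)^-1 : K) c.
pose E (c : P2) := series_in M.+2 (fun i => (i`!%:R)^-1 : K) c.
have EP c : E c = 1 + c * Psi c.
  rewrite /E /Psi /series_in big_ord_recl /= fact0 invr1 scale1r mulr_sumr.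
  by congr (_ + _); apply: eq_bigr => i _; rewrite exprS scalerAr.
have hw : ord_ge M.+2 (E a * E b - E (a + b)) := exp_add ha hb.
rewrite !EP in hw.
have hra := bern_dexp (M := M.+1) ha; have hrb := bern_dexp (M := M.+1) hb.
have hrs := bern_dexp (M := M.+1) hs.
have eb := bern_divdiffP M.+1 (a + b) b; rewrite addrK in eb.
have ea := bern_divdiffP M.+1 (a + b) a; rewrite [a + b - a]addrC addKr in ea.
rewrite /Z (bern_cross_multiplied ea eb).
rewrite (exp_cross_multiplied _ _ _ _ _ (Psi a) (Psi b) (Psi (a + b))).
apply: ord_geD; last exact: ord_geM1 hs hrs.
apply: ord_geB; last exact: ord_geM1 ha (ord_geD (ord_geD hra hrb) (ord_geMr _ hra)).
apply: ord_geB; last exact: ord_geM1 hb hrb.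
apply: ord_geB; last exact: ord_geM1 ha hra.
exact: ord_geMl hw.
Qed.

End TwoVariables.

(** * Polynomials evaluated at commuting endomorphisms *)

Section MonomialLift.
Variables (K : fieldType) (n : nat).

(** As [msize] is one more than the degree, a bound on it is the vanishing of
    the high-degree coefficients, a form that passes to derivatives and sums. *)
Lemma msize_leP (p : {mpoly K[n]}) d :
  (msize p <= d)%N <-> forall m, (d <= mdeg m)%N -> p@_m = 0.
Proof.
split=> [le_pd m le_dm|h].
  by apply/memN_msupp_eq0/msize_mdeg_ge/(leq_trans le_pd).
rewrite mmeasureE; apply/bigmax_leqP_seq => m; rewrite mcoeff_msupp => nz _.
by rewrite ltnNge; apply: contra nz => /h ->.
Qed.

Lemma msize_mderiv d (p : {mpoly K[n]}) i :
  (msize p <= d.+1)%N -> (msize p^`M(i) <= d)%N.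
Proof.
move/msize_leP=> h; apply/msize_leP => m le_dm.
by rewrite mcoeff_mderiv h ?mul0rn // mdegD mdeg1 addn1.
Qed.

Lemma mderiv_var i j : ('X_i : {mpoly K[n]})^`M(j) = (i == j)%:R.
Proof.
rewrite mderivX mnm1E; case: eqP => [->|_]; last by rewrite scale0r.
by rewrite scale1r -{1}[U_(j)%MM]add0m addmK mpolyX0.
Qed.

Lemma msize_varM i d (p : {mpoly K[n]}) :
  (msize p <= d)%N -> (msize ('X_i * p) <= d.+1)%N.
Proof.
move=> /msize_leP h; apply/msize_leP => m lt_m.
rewrite mcoeffM big1 // => -[m1 m2] /= /eqP e.
rewrite mcoeffX; case: eqP => [e1|]; last by rewrite mul0r.
have := congr1 mdeg e; rewrite mdegD -e1 mdeg1 => em.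
by rewrite h ?mulr0 // -ltnS -(add1n (mdeg m2)) -em.
Qed.

Lemma msize_sumZ d (I : finType) (c : I -> K) (p : I -> {mpoly K[n]}) :
  (forall i, (msize (p i) <= d)%N) -> (msize (\sum_i c i *: p i) <= d)%N.
Proof.
move=> h; apply/msize_leP => m le_dm; rewrite raddf_sum big1 //= => i _.
by have /msize_leP hi := h i; rewrite mcoeffZ hi ?mulr0.
Qed.

Variable W : lmodType K.

Definition mpoly_lift (F : 'X_{1..n} -> W) (p : {mpoly K[n]}) : W :=
  \sum_(m <- msupp p) p@_m *: F m.

Lemma mpoly_lift_linear F : linear (mpoly_lift F).
Proof.
have E i r : (msize r <= i)%N ->
    mpoly_lift F r = \sum_(m : 'X_{1..n < i}) r@_m *: F m.
  move=> le_ri; set I : subFinType _ := 'X_{1..n < i}.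
  rewrite /mpoly_lift (ssrcomplements.big_mksub I) ?msupp_uniq //=; first last.
    by move=> x /msize_mdeg_lt /leq_trans; apply.
  by rewrite big_rmcond //= => j /memN_msupp_eq0 ->; rewrite scale0r.
move=> c p q; pose i := maxn (msize (c *: p + q)) (maxn (msize p) (msize q)).
rewrite !(E i) ?leq_max ?leqnn ?orbT // scaler_sumr -big_split.
by apply: eq_bigr => m _ /=; rewrite mcoeffD mcoeffZ scalerDl -scalerA.
Qed.

HB.instance Definition _ F := GRing.isLinear.Build K {mpoly K[n]} W _
  (mpoly_lift F) (mpoly_lift_linear F).

Lemma mpoly_liftX F m : mpoly_lift F 'X_[m] = F m.
Proof. by rewrite /mpoly_lift msuppX big_seq1 mcoeffX eqxx scale1r. Qed.

Lemma mpoly_linear_ext (f h : {mpoly K[n]} -> W) : linear f -> linear h ->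
  (forall m, f 'X_[m] = h 'X_[m]) -> f =1 h.
Proof.
move=> fl hl e; elim/mpolyind => [|c m p _ _ IH]; last by rewrite fl hl e IH.
by rewrite !linear_fun0.
Qed.

End MonomialLift.

Section LinearIter.
Variables (K : fieldType) (W : lmodType K) (f : {linear W -> W}).
Lemma iter_linear k : linear (iter k f).
Proof. by elim: k => // k IH c u v; rewrite /= IH linearP. Qed.
HB.instance Definition _ k := GRing.isLinear.Build K W W _
  (iter k f) (iter_linear k).
End LinearIter.

Section CommutingEval.
Variables (K : fieldType) (W : lmodType K) (a b : {linear W -> W}).
Hypothesis ab_comm : forall w, a (b w) = b (a w).
Variable v : W.
Local Notation A := ('X_ord0 : {mpoly K[2]}).
Local Notation B := ('X_ord_max : {mpoly K[2]}).

(** The map [f |-> f(a, b) v] for commuting [a] and [b].  Following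
    the orbit of one vector takes the place of a ring of endomorphisms. *)
Definition comm_eval : {mpoly K[2]} -> W :=
  mpoly_lift (fun m : 'X_{1..2} => iter (m ord0) a (iter (m ord_max) b v)).
HB.instance Definition _ := GRing.Linear.on comm_eval.

Lemma comm_eval1 : comm_eval 1 = v.
Proof. by rewrite -mpolyX0 /comm_eval mpoly_liftX !mnmE. Qed.

Lemma comm_evalA f : comm_eval (A * f) = a (comm_eval f).
Proof.
move: f; apply: mpoly_linear_ext => [c f h|c f h|m].
- by rewrite mulrDr -scalerAr linearP.
- by rewrite !linearP.
rewrite -mpolyXD /comm_eval !mpoly_liftX !mnmE eqxx.
by rewrite (_ : ord0 == ord_max = false).
Qed.

Lemma comm_evalB f : comm_eval (B * f) = b (comm_eval f).
Proof.
move: f; apply: mpoly_linear_ext => [c f h|c f h|m].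
- by rewrite mulrDr -scalerAr linearP.
- by rewrite !linearP.
rewrite -mpolyXD /comm_eval !mpoly_liftX !mnmE eqxx.
rewrite (_ : ord_max == ord0 = false) //= add0n.
by elim: (m ord0) => //= k ->.
Qed.

Lemma comm_eval_ord N f :
    (forall i j, (N <= i + j)%N -> iter i a (iter j b v) = 0) ->
  ord_ge N f -> comm_eval f = 0.
Proof.
move=> nil hf; rewrite /comm_eval /mpoly_lift big1_seq // => m _.
have [lt_m|le_m] := ltnP (mdeg m) N; first by rewrite hf ?scale0r.
rewrite nil ?scaler0 //; move: le_m; rewrite mdegE big_ord_recl big_ord1.
by congr (_ <= _ + m _)%N; apply: val_inj.
Qed.

End CommutingEval.

(** The next lemmas apply a power series in [delta] to vectors obtained from
    [W2].  The map [beta] turns [delta] into multiplication by [s]; the map [mul]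
    turns it into multiplication by [v], up to an error [beta].  Moving [delta^m]
    through [mul] thus produces the divided difference of [s^m] and [v^m]. *)

Section Intertwining.
Variables (K : fieldType) (W1 W2 : lmodType K).
Variables (delta : {linear W1 -> W1}) (beta mul : {linear W2 -> W1}).
Variables (ev : {linear {mpoly K[2]} -> W2}) (s v : {mpoly K[2]}).
Hypothesis delta_beta : forall f, delta (beta (ev f)) = beta (ev (s * f)).
Hypothesis delta_mul :
  forall f, delta (mul (ev f)) = beta (ev f) + mul (ev (v * f)).

Lemma iter_delta_beta m f :
  iter m delta (beta (ev f)) = beta (ev (s ^+ m * f)).
Proof.
elim: m => [|m IH]; first by rewrite mul1r.
by rewrite iterS IH delta_beta mulrA -exprS.
Qed.

Lemma iter_delta_mul m f :
  iter m delta (mul (ev f))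
  = mul (ev (v ^+ m * f)) + beta (ev (pow_divdiff m s v * f)).
Proof.
elim: m => [|m IH] /=; first by rewrite mul1r mul0r !linear0 addr0.
rewrite IH linearD delta_mul delta_beta mulrDl !linearD /= mulrA -exprS mulrA.
by rewrite -addrA addrC -addrA.
Qed.

Lemma series_delta_mul M f :
  \sum_(m < M) bern K m *: iter m delta (mul (ev f))
  = mul (ev (series_in M (bern K) v * f)) + beta (ev (bern_divdiff M s v * f)).
Proof.
rewrite !mulr_suml !linear_sum -big_split; apply: eq_bigr => m _ /=.
by rewrite iter_delta_mul -!scalerAl !linearZ /= scalerDr.
Qed.

Lemma series_delta_beta M f :
  \sum_(m < M) bern K m *: iter m delta (beta (ev f))
  = beta (ev (series_in M (bern K) s * f)).
Proof.
rewrite mulr_suml !linear_sum; apply: eq_bigr => m _.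
by rewrite iter_delta_beta -scalerAl !linearZ.
Qed.

End Intertwining.

(** * Operators on vector-valued polynomials *)

Lemma exchange_big22 (V : nmodType) (I I' J J' : finType)
    (F : I -> I' -> J -> J' -> V) :
  \sum_i \sum_i' \sum_j \sum_j' F i i' j j'
  = \sum_j \sum_j' \sum_i \sum_i' F i i' j j'.
Proof.
transitivity (\sum_i \sum_j \sum_i' \sum_j' F i i' j j').
  by apply: eq_bigr => i _; exact: exchange_big.
rewrite exchange_big; apply: eq_bigr => j _.
transitivity (\sum_i \sum_j' \sum_i' F i i' j j').
  by apply: eq_bigr => i _; exact: exchange_big.
exact: exchange_big.
Qed.

Section Operators.
Variables (K : fieldType) (n : nat) (c : 'I_n -> 'I_n -> 'I_n -> K).
Local Notation S := {mpoly K[n]}.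
Local Notation W1 := {ffun 'I_n -> S}.
Local Notation W2 := {ffun 'I_n * 'I_n -> S}.

Lemma mderiv_sum (I : Type) (r : seq I) (P : pred I) (F : I -> S) i :
  (\sum_(j <- r | P j) F j)^`M(i) = \sum_(j <- r | P j) (F j)^`M(i).
Proof. exact: (raddf_sum (mderiv i)). Qed.

(** A vector [w] of [W1] is the element [sum_k e_k (x) w_k] of [g (x) S], where
    [c i j k] is the [e_k]-coefficient of [[e_i, e_j]]; likewise [W2] is
    [g (x) g (x) S].  Then [delta (x (x) p) = sum_i [e_i, x] (x) d^i p] and
    [mu (x (x) p) = x p]; [delta1], [delta2] and [mu1], [mu2] are these operations
    on the first and the second factor, and [brk (z (x) x (x) p) = [z, x] (x) p]. *)
Definition delta (w : W1) : W1 :=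
  [ffun l => \sum_i \sum_k c i k l *: (w k)^`M(i)].
Definition mu (w : W1) : S := \sum_k 'X_k * w k.
Definition delta1 (w : W2) : W2 :=
  [ffun jk => \sum_i \sum_j c i j jk.1 *: (w (j, jk.2))^`M(i)].
Definition delta2 (w : W2) : W2 :=
  [ffun jk => \sum_i \sum_k c i k jk.2 *: (w (jk.1, k))^`M(i)].
Definition mu1 (w : W2) : W1 := [ffun k => \sum_j 'X_j * w (j, k)].
Definition mu2 (w : W2) : W1 := [ffun j => \sum_k 'X_k * w (j, k)].
Definition brk (w : W2) : W1 :=
  [ffun l => \sum_j \sum_k c j k l *: w (j, k)].

Lemma delta_linear : linear delta.
Proof.
move=> e u w; apply/ffunP => l; rewrite !ffunE scaler_sumr -big_split.
apply: eq_bigr => i _ /=; rewrite scaler_sumr -big_split; apply: eq_bigr => k _ /=.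
by rewrite !ffunE linearP scalerDr !scalerA mulrC.
Qed.
HB.instance Definition _ := GRing.isLinear.Build K W1 W1 _ delta delta_linear.

Lemma delta1_linear : linear delta1.
Proof.
move=> e u w; apply/ffunP => l; rewrite !ffunE scaler_sumr -big_split.
apply: eq_bigr => i _ /=; rewrite scaler_sumr -big_split; apply: eq_bigr => k _ /=.
by rewrite !ffunE linearP scalerDr !scalerA mulrC.
Qed.
HB.instance Definition _ := GRing.isLinear.Build K W2 W2 _ delta1 delta1_linear.

Lemma delta2_linear : linear delta2.
Proof.
move=> e u w; apply/ffunP => l; rewrite !ffunE scaler_sumr -big_split.
apply: eq_bigr => i _ /=; rewrite scaler_sumr -big_split; apply: eq_bigr => k _ /=.
by rewrite !ffunE linearP scalerDr !scalerA mulrC.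
Qed.
HB.instance Definition _ := GRing.isLinear.Build K W2 W2 _ delta2 delta2_linear.

Lemma brk_linear : linear brk.
Proof.
move=> e u w; apply/ffunP => l; rewrite !ffunE scaler_sumr -big_split.
apply: eq_bigr => i _ /=; rewrite scaler_sumr -big_split; apply: eq_bigr => k _ /=.
by rewrite !ffunE scalerDr !scalerA mulrC.
Qed.
HB.instance Definition _ := GRing.isLinear.Build K W2 W1 _ brk brk_linear.

Lemma mu_linear : linear mu.
Proof.
move=> e u w; rewrite /mu scaler_sumr -big_split; apply: eq_bigr => k _ /=.
by rewrite !ffunE mulrDr scalerAr.
Qed.
HB.instance Definition _ := GRing.isLinear.Build K W1 S _ mu mu_linear.

Lemma mu1_linear : linear mu1.
Proof.
move=> e u w; apply/ffunP => l; rewrite !ffunE scaler_sumr -big_split.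
by apply: eq_bigr => k _ /=; rewrite !ffunE mulrDr scalerAr.
Qed.
HB.instance Definition _ := GRing.isLinear.Build K W2 W1 _ mu1 mu1_linear.

Lemma mu2_linear : linear mu2.
Proof.
move=> e u w; apply/ffunP => l; rewrite !ffunE scaler_sumr -big_split.
by apply: eq_bigr => k _ /=; rewrite !ffunE mulrDr scalerAr.
Qed.
HB.instance Definition _ := GRing.isLinear.Build K W2 W1 _ mu2 mu2_linear.

Lemma delta12_comm w : delta1 (delta2 w) = delta2 (delta1 w).
Proof.
apply/ffunP => -[j k]; rewrite !ffunE /=.
transitivity (\sum_i \sum_j' \sum_i' \sum_k'
    (c i j' j * c i' k' k) *: (w (j', k'))^`M(i)^`M(i')).
  apply: eq_bigr => i _; apply: eq_bigr => j' _.
  rewrite ffunE mderiv_sum scaler_sumr; apply: eq_bigr => i' _ /=.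
  rewrite mderiv_sum scaler_sumr; apply: eq_bigr => k' _ /=.
  by rewrite mderivZ scalerA mderiv_comm.
rewrite exchange_big22; apply: eq_bigr => i' _; apply: eq_bigr => k' _.
rewrite ffunE mderiv_sum scaler_sumr; apply: eq_bigr => i _ /=.
rewrite mderiv_sum scaler_sumr; apply: eq_bigr => j' _ /=.
by rewrite mderivZ scalerA mulrC.
Qed.

Lemma mu_mu12 w : mu (mu1 w) = mu (mu2 w).
Proof.
rewrite /mu; under eq_bigr => k _ do rewrite ffunE mulr_sumr.
rewrite exchange_big; apply: eq_bigr => j _; rewrite ffunE mulr_sumr.
by apply: eq_bigr => k _; rewrite mulrCA.
Qed.

(** The Leibniz rule: [d^i] falls on the linear factor [X_j], which gives the
    bracket, or on the polynomial. *)
Lemma delta_mu1 w : delta (mu1 w) = brk w + mu1 (delta2 w).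
Proof.
apply/ffunP => l; rewrite !ffunE.
transitivity (\sum_i \sum_k \sum_j (c i k l *: ((i == j)%:R * w (j, k))
     + c i k l *: ('X_j * (w (j, k))^`M(i)))).
  apply: eq_bigr => i _; apply: eq_bigr => k _.
  rewrite ffunE mderiv_sum scaler_sumr; apply: eq_bigr => j _ /=.
  by rewrite mderivM mderiv_var eq_sym scalerDr.
under eq_bigr do (under eq_bigr do rewrite big_split; rewrite big_split).
rewrite big_split; congr (_ + _).
  apply: eq_bigr => i _; apply: eq_bigr => k _; rewrite (bigD1 i) //= eqxx mul1r.
  by rewrite big1 ?addr0 // => j /negbTE; rewrite eq_sym => ->; rewrite mul0r scaler0.
under [RHS]eq_bigr => j _.
  rewrite ffunE mulr_sumr.
  under eq_bigr => i _ do rewrite mulr_sumr.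
  over.
rewrite [RHS]exchange_big; apply: eq_bigr => i _ /=; rewrite exchange_big.
by apply: eq_bigr => j _; apply: eq_bigr => k _; rewrite scalerAr.
Qed.

Hypothesis c_anti : forall i j k, c i j k = - c j i k.

Lemma delta_mu2 w : delta (mu2 w) = - brk w + mu2 (delta1 w).
Proof.
pose sw (u : W2) : W2 := [ffun jk => u (jk.2, jk.1)].
have -> : mu2 w = mu1 (sw w).
  by apply/ffunP => k; rewrite !ffunE; apply: eq_bigr => j _; rewrite ffunE.
rewrite delta_mu1; congr (_ + _).
  apply/ffunP => l; rewrite !ffunE exchange_big -sumrN; apply: eq_bigr => k _.
  by rewrite -sumrN; apply: eq_bigr => j _; rewrite ffunE c_anti scaleNr.
apply/ffunP => k; rewrite !ffunE; apply: eq_bigr => j _; rewrite !ffunE /=.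
by congr (_ * _); do 2![apply: eq_bigr => ? _]; rewrite ffunE.
Qed.

Hypothesis c_jacobi : forall i j k l,
  \sum_m (c i m l * c j k m + c j m l * c k i m + c k m l * c i j m) = 0.

(** The Jacobi identity: [[e_i, _]] is a derivation of the bracket. *)
Lemma delta_brk w : delta (brk w) = brk (delta1 w + delta2 w).
Proof.
apply/ffunP => l; rewrite !ffunE.
transitivity (\sum_i \sum_j \sum_k
    (\sum_m c i m l * c j k m) *: (w (j, k))^`M(i)).
  apply: eq_bigr => i _.
  transitivity (\sum_m \sum_j \sum_k (c i m l * c j k m) *: (w (j, k))^`M(i)).
    apply: eq_bigr => m _; rewrite ffunE mderiv_sum scaler_sumr.
    apply: eq_bigr => j _ /=; rewrite mderiv_sum scaler_sumr.
    by apply: eq_bigr => k _ /=; rewrite mderivZ scalerA.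
  rewrite exchange_big; apply: eq_bigr => j _ /=; rewrite exchange_big.
  by apply: eq_bigr => k _; rewrite scaler_suml.
transitivity (\sum_i \sum_j \sum_k ((\sum_m c m k l * c i j m) *: (w (j, k))^`M(i)
   + (\sum_m c j m l * c i k m) *: (w (j, k))^`M(i))).
  apply: eq_bigr => i _; apply: eq_bigr => j _; apply: eq_bigr => k _.
  rewrite -scalerDl -big_split; congr (_ *: _).
  apply/eqP; rewrite -subr_eq0 -sumrB /=.
  rewrite -[X in _ == X](c_jacobi i j k l); apply/eqP; apply: eq_bigr => m _.
  rewrite (c_anti k i) (c_anti k m); ring.
transitivity (\sum_j \sum_k c j k l *: delta1 w (j, k)
              + \sum_j \sum_k c j k l *: delta2 w (j, k)); last first.
  rewrite -big_split; apply: eq_bigr => j _; rewrite -big_split.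
  by apply: eq_bigr => k _ /=; rewrite -scalerDr [(delta1 w + delta2 w) _]ffunE.
transitivity (\sum_i \sum_j \sum_k (\sum_m c m k l * c i j m) *: (w (j, k))^`M(i)
   + \sum_i \sum_j \sum_k (\sum_m c j m l * c i k m) *: (w (j, k))^`M(i)).
  rewrite -big_split; apply: eq_bigr => i _; rewrite -big_split.
  by apply: eq_bigr => j _; rewrite -big_split.
congr (_ + _).
  transitivity (\sum_i \sum_j \sum_m \sum_k (c m k l * c i j m) *: (w (j, k))^`M(i)).
    apply: eq_bigr => i _; apply: eq_bigr => j _; rewrite exchange_big.
    by apply: eq_bigr => k _; rewrite scaler_suml.
  rewrite exchange_big22; apply: eq_bigr => m _; apply: eq_bigr => k _.
  rewrite ffunE scaler_sumr; apply: eq_bigr => i _; rewrite scaler_sumr.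
  by apply: eq_bigr => j _; rewrite scalerA.
transitivity (\sum_i \sum_k \sum_j \sum_m (c j m l * c i k m) *: (w (j, k))^`M(i)).
  apply: eq_bigr => i _; rewrite exchange_big; apply: eq_bigr => k _.
  by apply: eq_bigr => j _; rewrite scaler_suml.
rewrite exchange_big22; apply: eq_bigr => j _; apply: eq_bigr => m _.
rewrite ffunE scaler_sumr; apply: eq_bigr => i _; rewrite scaler_sumr.
by apply: eq_bigr => k _; rewrite scalerA.
Qed.

End Operators.

(** * The Bernoulli operator and its commutation relation *)

Section Gutt.
Variables (K : fieldType) (n : nat) (c : 'I_n -> 'I_n -> 'I_n -> K).
Local Notation S := {mpoly K[n]}.
Local Notation W1 := {ffun 'I_n -> S}.
Local Notation W2 := {ffun 'I_n * 'I_n -> S}.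
Local Notation delta := (delta c).
Local Notation delta1 := (delta1 c).
Local Notation delta2 := (delta2 c).
Local Notation brk := (brk c).

Definition wsize (I : finType) (w : {ffun I -> S}) : nat :=
  \max_k msize (w k).

Lemma wsize_leP (I : finType) d (w : {ffun I -> S}) :
  reflect (forall k, (msize (w k) <= d)%N) (wsize w <= d)%N.
Proof. by apply: (iffP (bigmax_leqP _ _ _)) => h k //; apply: h. Qed.

Lemma wsize_eq0 (I : finType) (w : {ffun I -> S}) : (wsize w <= 0)%N -> w = 0.
Proof.
move/wsize_leP=> h; apply/ffunP => k; rewrite ffunE; apply/eqP.
by rewrite -msize_poly_eq0 -leqn0.
Qed.

Lemma wsize_delta d w : (wsize w <= d.+1)%N -> (wsize (delta w) <= d)%N.
Proof.
move/wsize_leP=> h; apply/wsize_leP => l; rewrite ffunE pair_big /=.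
by apply: msize_sumZ => -[i k] /=; apply/msize_mderiv/h.
Qed.

Lemma wsize_delta1 d w : (wsize w <= d.+1)%N -> (wsize (delta1 w) <= d)%N.
Proof.
move/wsize_leP=> h; apply/wsize_leP => l; rewrite ffunE pair_big /=.
by apply: msize_sumZ => -[i k] /=; apply/msize_mderiv/h.
Qed.

Lemma wsize_delta2 d w : (wsize w <= d.+1)%N -> (wsize (delta2 w) <= d)%N.
Proof.
move/wsize_leP=> h; apply/wsize_leP => l; rewrite ffunE pair_big /=.
by apply: msize_sumZ => -[i k] /=; apply/msize_mderiv/h.
Qed.

Lemma wsize_iter (I : finType) (f : {ffun I -> S} -> {ffun I -> S}) :
    (forall d w, (wsize w <= d.+1)%N -> (wsize (f w) <= d)%N) ->
  forall k d w, (wsize w <= d)%N -> (wsize (iter k f w) <= d - k)%N.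
Proof.
move=> hf k; elim: k => [|k IH] d w hw; first by rewrite subn0.
rewrite iterSr subnS -subn1 subnAC subn1; apply: IH.
by apply: hf; apply: leq_trans hw (leqSpred _).
Qed.

Lemma iter_delta0 k d w : (wsize w <= d)%N -> (d <= k)%N -> iter k delta w = 0.
Proof.
move=> hw; rewrite -subn_eq0 => /eqP e; apply: wsize_eq0; rewrite -e.
exact: (wsize_iter wsize_delta).
Qed.

Lemma wsize_mu d w : (wsize w <= d)%N -> (msize (mu w) <= d.+1)%N.
Proof.
move/wsize_leP=> h; rewrite /mu -(eq_bigr _ (fun k _ => scale1r ('X_k * w k))).
by apply: msize_sumZ => k; apply: msize_varM.
Qed.

(** The locally finite sum [mu phi(delta)], which is [x (x) p |-> rho_x p].
    Since [delta] lowers the degree, the size of [w] bounds the nonzero terms, and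
    [bernopE] replaces that bound by any larger one. *)
Definition bernop (w : W1) : S :=
  \sum_(m < wsize w) bern K m *: mu (iter m delta w).

Lemma bernopE M w : (wsize w <= M)%N ->
  bernop w = mu (\sum_(m < M) bern K m *: iter m delta w).
Proof.
move=> le_wM; rewrite linear_sum /bernop.
rewrite -!(big_mkord xpredT (fun m => bern K m *: mu (iter m delta w))).
under [RHS]eq_bigr => m _ do rewrite linearZ.
rewrite -(big_mkord xpredT (fun m => bern K m *: mu (iter m delta w))).
rewrite (big_cat_nat _ le_wM) //= [X in _ + X]big_nat [X in _ + X]big1 ?addr0 //.
by move=> m /andP[le_m _]; rewrite (iter_delta0 _ le_m) // linear0 scaler0.
Qed.

Lemma bernop_linear : linear bernop.
Proof.
move=> e u w; pose M := maxn (wsize (e *: u + w)) (maxn (wsize u) (wsize w)).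
rewrite !(@bernopE M) ?leq_max ?leqnn ?orbT // -linearP; congr mu.
rewrite scaler_sumr -big_split; apply: eq_bigr => m _ /=.
by rewrite linearP scalerDr !scalerA mulrC.
Qed.
HB.instance Definition _ := GRing.isLinear.Build K W1 S _ bernop bernop_linear.

(** [tens x p] is [x (x) p]; [tens1] and [tens2] insert [x] as the second,
    respectively the first factor, so that [mu1], respectively [mu2], acts on the
    factor that was already there. *)
Definition tens (x : 'I_n -> K) (p : S) : W1 := [ffun k => x k *: p].
Definition tens1 (x : 'I_n -> K) (w : W1) : W2 := [ffun jk => x jk.2 *: w jk.1].
Definition tens2 (x : 'I_n -> K) (w : W1) : W2 := [ffun jk => x jk.1 *: w jk.2].

Lemma tens_mu1 x w : tens x (mu w) = mu1 (tens1 x w).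
Proof.
apply/ffunP => k; rewrite !ffunE scaler_sumr; apply: eq_bigr => j _.
by rewrite ffunE scalerAr.
Qed.

Lemma tens_mu2 x w : tens x (mu w) = mu2 (tens2 x w).
Proof.
apply/ffunP => k; rewrite !ffunE scaler_sumr; apply: eq_bigr => j _.
by rewrite ffunE scalerAr.
Qed.

Lemma tens1_delta x w : tens1 x (delta w) = delta1 (tens1 x w).
Proof.
apply/ffunP => -[j k]; rewrite !ffunE /= scaler_sumr; apply: eq_bigr => i _.
rewrite scaler_sumr; apply: eq_bigr => l _.
by rewrite !ffunE mderivZ !scalerA mulrC.
Qed.

Lemma tens2_delta x w : tens2 x (delta w) = delta2 (tens2 x w).
Proof.
apply/ffunP => -[j k]; rewrite !ffunE /= scaler_sumr; apply: eq_bigr => i _.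
rewrite scaler_sumr; apply: eq_bigr => l _.
by rewrite !ffunE mderivZ !scalerA mulrC.
Qed.

Lemma tens1_linear x : linear (tens1 x).
Proof. by move=> e u w; apply/ffunP => jk; rewrite !ffunE scalerDr !scalerA mulrC. Qed.
HB.instance Definition _ x := GRing.isLinear.Build K W1 W2 _ _ (tens1_linear x).
Lemma tens2_linear x : linear (tens2 x).
Proof. by move=> e u w; apply/ffunP => jk; rewrite !ffunE scalerDr !scalerA mulrC. Qed.
HB.instance Definition _ x := GRing.isLinear.Build K W1 W2 _ _ (tens2_linear x).
Lemma tens_linear x : linear (tens x).
Proof. by move=> e u w; apply/ffunP => jk; rewrite !ffunE scalerDr !scalerA mulrC. Qed.
HB.instance Definition _ x := GRing.isLinear.Build K S W1 _ _ (tens_linear x).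

Lemma tens12 x z p : tens1 x (tens z p) = tens2 z (tens x p).
Proof. by apply/ffunP => jk; rewrite !ffunE !scalerA mulrC. Qed.

Lemma wsize_tens x p d : (msize p <= d)%N -> (wsize (tens x p) <= d)%N.
Proof.
move=> h; apply/wsize_leP => k; rewrite ffunE; apply/msize_leP => m le_m.
by move/msize_leP: h => h; rewrite mcoeffZ h ?mulr0.
Qed.

Lemma wsize_tens1 x w d : (wsize w <= d)%N -> (wsize (tens1 x w) <= d)%N.
Proof.
move/wsize_leP=> h; apply/wsize_leP => k; rewrite ffunE; apply/msize_leP => m le_m.
by have /msize_leP h' := h k.1; rewrite mcoeffZ h' ?mulr0.
Qed.

Lemma wsize_delta_le w d : (wsize w <= d)%N -> (wsize (delta w) <= d)%N.
Proof. by move=> h; apply: leq_trans (wsize_delta (leqW h)) _. Qed.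

Lemma msize_bernop w d : (wsize w <= d)%N -> (msize (bernop w) <= d.+1)%N.
Proof.
move=> hw; rewrite (bernopE hw); apply: wsize_mu; apply/wsize_leP => k.
rewrite sum_ffunE; under eq_bigr => m _ do rewrite ffunE.
apply: msize_sumZ => m; move: k; apply/wsize_leP.
by elim: (m : nat) => //= k IH; apply: wsize_delta_le.
Qed.

Hypothesis charK : [pchar K] =i pred0.
Hypothesis c_anti : forall i j k, c i j k = - c j i k.
Hypothesis c_jacobi : forall i j k l,
  \sum_m (c i m l * c j k m + c j m l * c k i m + c k m l * c i j m) = 0.

Lemma mu_brk_cancel (w w1 w2 w3 : W2) : w1 + w2 + w3 = 0 ->
  mu (mu1 w + brk w1) - mu (mu2 w - brk w2) = - mu (brk w3).
Proof.
move=> e; have -> : w3 = - (w1 + w2) by rewrite -[RHS]add0r -e addrAC subrr add0r.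
have -> : mu (mu2 w - brk w2) = mu (mu2 w) - mu (brk w2) by rewrite linearB.
have -> : mu (brk (- (w1 + w2))) = - (mu (brk w1) + mu (brk w2)).
  rewrite -[- (w1 + w2)]scaleN1r !linearZ /= -scaleN1r; congr (_ *: _).
  by rewrite !linearD.
rewrite linearD /= mu_mu12 opprK.
by rewrite opprD opprK addrACA subrr add0r.
Qed.

(** Both [rho_x rho_z p] and [rho_z rho_x p] are computed from the same vector
    [v = z (x) x (x) p], multiplying its first or its second factor into the
    polynomial first.  The main terms [phi(a) phi(b) v] agree, and the divided
    differences that remain add up to [- phi(a + b) v] by [bern_identity]. *)
Lemma bernop_comm x z p :
  bernop (tens x (bernop (tens z p))) - bernop (tens z (bernop (tens x p)))
  = bernop (brk (tens1 z (tens x p))).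
Proof.
(* Acting by [rho_z] raises the size of [p] by one at most. *)
set M := (msize p).+1; set v := tens1 x (tens z p).
pose a := 'X_ord0 : {mpoly K[2]}; pose b := 'X_ord_max : {mpoly K[2]}.
pose ev : {linear {mpoly K[2]} -> W2} := comm_eval delta1 delta2 v.
have evA := comm_evalA delta1 delta2 v : forall f, ev (a * f) = delta1 (ev f).
have evB : forall f, ev (b * f) = delta2 (ev f).
  by apply: comm_evalB; exact: delta12_comm.
have evS f : ev ((a + b) * f) = delta1 (ev f) + delta2 (ev f).
  by rewrite mulrDl linearD /= evA evB.
pose Phi (f : {mpoly K[2]}) := series_in M (bern K) f.
have bz : bernop (tens z p) = mu (\sum_(m < M) bern K m *: iter m delta (tens z p)).
  by apply/bernopE/wsize_tens/leqnSn.
have bx : bernop (tens x p) = mu (\sum_(m < M) bern K m *: iter m delta (tens x p)).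
  by apply/bernopE/wsize_tens/leqnSn.
have sz y y' : (wsize (tens y (bernop (tens y' p))) <= M)%N.
  by apply/wsize_tens/msize_bernop/wsize_tens.
have sv : (wsize v <= msize p)%N by apply/wsize_tens1/wsize_tens.
have ev1 : ev 1 = v by exact: comm_eval1.
have E1 : tens x (bernop (tens z p)) = mu1 (ev (Phi a)).
  rewrite bz tens_mu1; congr mu1.
  have := @series_delta_beta K _ _ delta1 idfun ev a (fun f => esym (evA f)) M 1.
  rewrite /= mulr1 => <-; rewrite linear_sum; apply: eq_bigr => m _.
  rewrite linearZ /= ev1; congr (_ *: _).
  by elim: (m : nat) => //= k <-; rewrite tens1_delta.
have E2 : tens z (bernop (tens x p)) = mu2 (ev (Phi b)).
  rewrite bx tens_mu2; congr mu2.
  have := @series_delta_beta K _ _ delta2 idfun ev b (fun f => esym (evB f)) M 1.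
  rewrite /= mulr1 => <-; rewrite linear_sum; apply: eq_bigr => m _.
  rewrite linearZ /= ev1 /v tens12; congr (_ *: _).
  by elim: (m : nat) => //= k <-; rewrite tens2_delta.
have EB f : delta (brk (ev f)) = brk (ev ((a + b) * f)).
  by rewrite delta_brk // evS.
rewrite (bernopE (sz x z)) E1.
rewrite (bernopE (sz z x)) E2.
have B : brk (tens1 z (tens x p)) = - brk v.
  apply/ffunP => l; rewrite !ffunE exchange_big -sumrN; apply: eq_bigr => k _.
  rewrite -sumrN; apply: eq_bigr => j _; rewrite !ffunE c_anti /= scaleNr.
  by rewrite !scalerA -mulrA [z _ * _]mulrC.
have szB : (wsize (brk v) <= M)%N.
  apply/wsize_leP => l; rewrite ffunE pair_big /=; apply: msize_sumZ => -[j k].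
  by apply: leq_trans (leqnSn _); move/wsize_leP: sv; apply.
have -> : bernop (brk (tens1 z (tens x p))) = - bernop (brk v).
  by rewrite B; exact: linearN.
rewrite (bernopE szB) -ev1 (series_delta_beta EB) mulr1.
pose nbrk : {linear W2 -> W1} := \- brk.
have EM1 f : delta (mu1 (ev f)) = brk (ev f) + mu1 (ev (b * f)).
  by rewrite delta_mu1 evB.
rewrite (series_delta_mul EB EM1).
have EN f : delta (nbrk (ev f)) = nbrk (ev ((a + b) * f)).
  by rewrite /= -EB raddfN.
have EM2 f : delta (mu2 (ev f)) = nbrk (ev f) + mu2 (ev (a * f)).
  by rewrite delta_mu2 // evA.
rewrite (series_delta_mul EN EM2).
rewrite [series_in M (bern K) b * _]mulrC; apply: mu_brk_cancel; rewrite -!linearD /=.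
rewrite (comm_eval_ord (N := msize p)) //.
  move=> i j le_ij; apply: wsize_eq0.
  have: (wsize (iter i delta1 (iter j delta2 v)) <= msize p - j - i)%N.
    apply: (wsize_iter wsize_delta1); exact: (wsize_iter wsize_delta2).
  by rewrite -subnDA addnC (eqP le_ij).
exact: (@bern_identity K charK M).
Qed.

End Gutt.

(** * Euler's operator and symmetrized products *)

Section Euler.
Variables (K : fieldType) (n : nat).
Hypothesis charK : [pchar K] =i pred0.
Local Notation S := {mpoly K[n]}.

(** The element [sum_i e_i (x) d^i p] of [g (x) S]; [mu (grad p)] is the Euler
    operator applied to [p]. *)
Definition grad (p : S) : {ffun 'I_n -> S} := [ffun x => p^`M(x)].

Lemma mu_gradX m : mu (grad 'X_[m]) = (mdeg m)%:R *: 'X_[m].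
Proof.
rewrite mdegE natr_sum scaler_suml; apply: eq_bigr => x _.
rewrite ffunE mderivX -scalerAr -mpolyXD.
case: (posnP (m x)) => [->|m_gt0]; first by rewrite !scale0r.
by rewrite addmC submK // lep1mP -lt0n.
Qed.

(** On a monomial of degree [k > 0] the Euler operator is multiplication by [k],
    which is invertible, and the partial derivatives have degree [k - 1]. *)
Lemma euler_ind (P : S -> Prop) :
    (forall c p q, P p -> P q -> P (c *: p + q)) -> P 1 ->
    (forall p, (forall x, P p^`M(x)) -> P (mu (grad p))) ->
  forall p, P p.
Proof.
move=> PD P1 PE; have P0 : P 0 by have := PD (-1) _ _ P1 P1; rewrite scaleN1r addNr.
have PZ c p : P p -> P (c *: p) by move=> Pp; rewrite -[_ *: _]addr0; apply: PD.
suff PX k m : mdeg m = k -> P 'X_[m].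
  by elim/mpolyind => [|c m p _ _ Pp] //; apply: PD => //; apply: (PX (mdeg m)).
elim: k m => [|k IH] m em.
  by move/eqP: em; rewrite mdeg_eq0 => /eqP ->; rewrite mpolyX0.
have k_neq0 : k.+1%:R != 0 :> K by rewrite ((pcharf0P K).1 charK).
rewrite -['X_[m]](scalerK k_neq0) -em -mu_gradX; apply/PZ/PE => x.
rewrite mderivX; case: (posnP (m x)) => [->|m_gt0]; first by rewrite scale0r.
apply/PZ/IH/eqP; rewrite -eqSS -em.
rewrite -[in X in _ == X](@submK _ U_(x) m) ?mdegD ?mdeg1 ?addn1 //.
by rewrite lep1mP -lt0n.
Qed.

Variable c : 'I_n -> 'I_n -> 'I_n -> K.
Hypothesis c_anti : forall i j k, c i j k = - c j i k.

Lemma antisym_sum_eq0 (V : lmodType K) (F : 'I_n -> 'I_n -> V) :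
  (forall i j, F i j = - F j i) -> \sum_i \sum_j F i j = 0.
Proof.
move=> hF; set s := LHS; have sN : s = - s.
  rewrite {1}/s exchange_big -sumrN; apply: eq_bigr => i _; rewrite -sumrN.
  by apply: eq_bigr => j _; rewrite hF.
have two_neq0 : 2 != 0 :> K by rewrite ((pcharf0P K).1 charK).
apply: (scalerI two_neq0); rewrite scaler0 scaler_nat mulr2n.
by rewrite {1}sN addNr.
Qed.

Lemma delta_grad p : delta c (grad p) = 0.
Proof.
apply/ffunP => l; rewrite !ffunE.
under eq_bigr => i _ do under eq_bigr => k _ do rewrite ffunE.
by apply: antisym_sum_eq0 => i j; rewrite c_anti scaleNr mderiv_comm.
Qed.

(** [sum_i rho_(e_i) (d^i p)] has only its term of order 0: already
    [delta (grad p)] contracts the antisymmetric [[e_i, e_k]] with the symmetric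
    [d^i d^k p]. *)
Lemma bernop_grad p : bernop c (grad p) = mu (grad p).
Proof.
rewrite (@bernopE _ _ _ (wsize (grad p)).+1) // big_ord_recl bern0 scale1r.
rewrite big1 ?addr0 // => i _.
by rewrite iterSr delta_grad linear0 scaler0.
Qed.

End Euler.

Section Symmetrization.
Variables (K : fieldType) (A : algType K).
Hypothesis charK : [pchar K] =i pred0.

(** The permutations are sorted by the value [j] that they take first. *)
Lemma symmetrization_rec k (Y : 'I_k.+1 -> A) :
  k.+1%:R *: symmetrization Y
  = \sum_j Y j * symmetrization (fun i => Y (lift j i)).
Proof.
rewrite /symmetrization scalerA factS natrM invfM mulVKf; last first.
  by rewrite ((pcharf0P K).1 charK).
under [RHS]eq_bigr do rewrite -scalerAr mulr_sumr.
rewrite -scaler_sumr pair_big /=; congr (_ *: _).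
pose f (p : 'I_k.+1 * 'S_k) := lift_perm ord0 p.1 p.2.
have f_inj : injective f.
  move=> [j s] [j' s'] /permP e; have := e ord0; rewrite !lift_perm_id /= => ej; subst j'.
  congr pair; apply/permP => i; have := e (lift ord0 i).
  by rewrite !lift_perm_lift => /lift_inj.
rewrite (reindex f) /=; last first.
  apply/onW_bij/inj_card_bij => //.
  by rewrite card_prod !card_Sn card_ord factS.
apply: eq_bigr => -[j s] _; rewrite big_ord_recl /f lift_perm_id; congr (_ * _).
by apply: eq_bigr => i _; rewrite lift_perm_lift.
Qed.

End Symmetrization.

Section PBW.
Variables (K : fieldType) (g : vectType K) (br : g -> g -> g).
Variables (n : nat) (X : n.-tuple g).
Hypothesis charK : [pchar K] =i pred0.
Hypothesis X_basis : basis_of fullv X.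
Local Notation S := {mpoly K[n]}.

Lemma coord_tnth i j : coord X j (tnth X i) = (i == j)%:R.
Proof. by rewrite (tnth_nth 0) coord_free // (basis_free X_basis). Qed.

Lemma coord_sum x : x = \sum_i coord X i x *: tnth X i.
Proof.
rewrite {1}(coord_basis X_basis (memvf x)).
by apply: eq_bigr => i _; rewrite (tnth_nth 0).
Qed.

Lemma to_S_tnth i : to_S X (tnth X i) = 'X_i.
Proof.
rewrite /to_S (bigD1 i) //= coord_tnth eqxx scale1r big1 ?addr0 // => j ne_ji.
by rewrite coord_tnth eq_sym (negbTE ne_ji) scale0r.
Qed.

Section Euler.
Variable t : K.
Local Notation Ut := (Ut br X t).
Local Notation e := (fun i => to_Ut br X t (tnth X i)).
Local Notation I := (I_PBW br X t).

HB.instance Definition _ :=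
  GRing.isLinear.Build K S Ut _ (I_PBW br X t) (@I_PBW_linear K g br n X t).

Lemma I_PBW_word k (w : 'I_k -> 'I_n) :
  I 'X_[(\sum_i U_(w i))%MM] = symmetrization (fun i => e (w i)).
Proof.
have := I_PBW_prod br t X_basis (fun i => tnth X (w i)).
rewrite (eq_bigr (fun i => 'X_(w i))) => [|i _]; last exact: to_S_tnth.
by rewrite mprodXE.
Qed.

Lemma mnm_word (m : 'X_{1..n}) :
  exists k (w : 'I_k -> 'I_n), m = (\sum_i U_(w i))%MM /\ mdeg m = k.
Proof.
exists (size (m2s m)), (tnth (in_tuple (m2s m))); split; last exact/esym/size_m2s.
apply/mnmP => j; rewrite mnm_sumE -{1}(s2mK m) mnmE -sum1_count big_mkcond /=.
rewrite -(big_tnth _ _ (m2s m) xpredT (fun i => U_(i)%MM j)) /=.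
by apply: eq_bigr => i _; rewrite mnm1E; case: eqP.
Qed.

Lemma I_PBW1 : I 1 = 1.
Proof.
have := I_PBW_prod br t X_basis (fun i : 'I_0 => 0).
rewrite big_ord0 => ->; rewrite /symmetrization fact0 invr1 scale1r.
rewrite (eq_bigr (fun=> 1)) => [|s _]; last by rewrite big_ord0.
by rewrite sumr_const card_Sn.
Qed.

(** For the monomial [X_w1 .. X_wk] this is [symmetrization_rec]: the [j]-th term
    there has first factor [e_wj], and the Leibniz rule collects in [d^i] the
    positions [j] with [wj = i]. *)
Lemma I_PBW_euler p : I (mu (grad p)) = \sum_i e i * I p^`M(i).
Proof.
move: p; apply: mpoly_linear_ext => [c p q|c p q|m].
- have -> : mu (grad (c *: p + q)) = c *: mu (grad p) + mu (grad q).
    rewrite -linearP; congr mu; apply/ffunP => i.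
    by rewrite !ffunE linearP.
  exact: I_PBW_linear.
- rewrite scaler_sumr -big_split; apply: eq_bigr => i _ /=.
  by rewrite linearP I_PBW_linear mulrDr scalerAr.
have [[|k] [w [em dm]]] := mnm_word m.
  move/eqP: dm; rewrite mdeg_eq0 => /eqP ->; rewrite mpolyX0.
  have d1 i : (1 : S)^`M(i) = 0 by exact: (mderivC i 1).
  have -> : mu (grad (1 : S)) = 0.
    by rewrite /mu big1 // => i _; rewrite ffunE d1 mulr0.
  by rewrite linear0 big1 // => i _; rewrite d1 linear0 mulr0.
have IZ c p : I (c *: p) = c *: I p by exact: linearZ.
rewrite mu_gradX dm IZ {1}em I_PBW_word symmetrization_rec //.
transitivity (\sum_i \sum_j (w j == i)%:R *: (e i * I 'X_[m - U_(i)])); last first.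
  apply: eq_bigr => i _; rewrite mderivX IZ -scalerAr -scaler_suml; congr (_ *: _).
  by rewrite em mnm_sumE -natr_sum; congr _%:R; apply: eq_bigr => j _; rewrite mnm1E.
rewrite exchange_big; apply: eq_bigr => j _.
rewrite (bigD1 (w j)) //= eqxx scale1r big1 ?addr0; last first.
  by move=> i /negbTE; rewrite eq_sym => ->; rewrite scale0r.
congr (_ * _); rewrite -I_PBW_word; congr (I 'X_[_]).
by rewrite em (bigD1_ord j) //= addmC addmK.
Qed.

End Euler.
End PBW.

(** * Injectivity of the symmetrization map *)

Section LieCoord.
Variables (K : fieldType) (g : vectType K) (br : g -> g -> g).
Hypothesis hbr : lie_bracket br.

Lemma lie_linearl y : linear (br^~ y).
Proof. by move=> c x x'; have [[fl _] _ _] := hbr; exact: fl. Qed.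

Lemma lie_linearr x : linear (br x).
Proof. by move=> c y y'; have [[_ fr] _ _] := hbr; exact: fr. Qed.

Lemma lie_skew x y : br x y = - br y x.
Proof.
have [_ alt _] := hbr; apply/eqP; rewrite -addr_eq0.
have lD z : br (x + y) z = br x z + br y z.
  by have := lie_linearl z 1 x y; rewrite !scale1r.
have rD z : br z (x + y) = br z x + br z y.
  by have := lie_linearr z 1 x y; rewrite !scale1r.
by have := alt (x + y); rewrite lD !rD !alt add0r addr0 => ->.
Qed.

Variables (n : nat) (X : n.-tuple g).
Hypothesis X_basis : basis_of fullv X.

Lemma coord_br x y k : coord X k (br x y) =
  \sum_i \sum_j coord X i x * coord X j y * struct_const br X i j k.
Proof.
rewrite {1}(coord_sum X_basis x) (linear_comb (lie_linearl y)) linear_sum.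
apply: eq_bigr => i _; rewrite linearZ /= {1}(coord_sum X_basis y).
rewrite (linear_comb (lie_linearr _)) linear_sum mulr_sumr.
by apply: eq_bigr => j _; rewrite linearZ /= mulrA.
Qed.

Variable t : K.
(** [U_t] of the bracket is [U_1] of [t] times the bracket, so the parameter is
    absorbed in the structure constants. *)
Definition tstruct i j k : K := t * struct_const br X i j k.

Lemma tstruct_anti i j k : tstruct i j k = - tstruct j i k.
Proof. by rewrite /tstruct /struct_const lie_skew linearN mulrN. Qed.

Lemma tstruct_jacobi i j k l :
  \sum_m (tstruct i m l * tstruct j k m + tstruct j m l * tstruct k i m
          + tstruct k m l * tstruct i j m) = 0.
Proof.
have E p q r : \sum_m tstruct p m l * tstruct q r m
    = t ^+ 2 * coord X l (br (tnth X p) (br (tnth X q) (tnth X r))).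
  rewrite {1}(coord_sum X_basis (br (tnth X q) (tnth X r))).
  rewrite (linear_comb (lie_linearr _)) linear_sum mulr_sumr.
  apply: eq_bigr => m _; rewrite linearZ /= /tstruct /struct_const; ring.
rewrite !big_split /= !E -!mulrDr -!linearD /=.
by have [_ _ ->] := hbr; rewrite linear0 mulr0.
Qed.

Local Notation S := {mpoly K[n]}.

Definition coords (x : g) : 'I_n -> K := fun i => coord X i x.

Lemma brk_tens x y (p : S) :
  brk tstruct (tens1 (coords y) (tens (coords x) p)) = t *: tens (coords (br x y)) p.
Proof.
apply/ffunP => k; rewrite !ffunE scalerA /coords coord_br mulr_sumr scaler_suml.
apply: eq_bigr => i _; rewrite mulr_sumr scaler_suml; apply: eq_bigr => j _.
rewrite !ffunE /= !scalerA /tstruct; congr (_ *: _); ring.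
Qed.

Definition bern_rho (i : 'I_n) : {linear S -> S} :=
  bernop tstruct \o tens (fun k => (i == k)%:R).

Lemma bern_lin_act x p :
  lin_act bern_rho X x p = bernop tstruct (tens (coords x) p).
Proof.
have -> : tens (coords x) p = \sum_i coord X i x *: tens (fun k => (i == k)%:R) p.
  apply/ffunP => k; rewrite ffunE sum_ffunE (bigD1 k) //= !ffunE eqxx scale1r.
  rewrite big1 ?addr0 // => i /negbTE ne_ik; rewrite !ffunE ne_ik.
  by rewrite scale0r scaler0.
by rewrite linear_sum; apply: eq_bigr => i _; rewrite linearZ.
Qed.

Hypothesis charK : [pchar K] =i pred0.

Lemma bern_rep x y p :
  lin_act bern_rho X x (lin_act bern_rho X y p)
  - lin_act bern_rho X y (lin_act bern_rho X x p)
  = t *: lin_act bern_rho X (br x y) p.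
Proof.
rewrite !bern_lin_act (bernop_comm charK tstruct_anti tstruct_jacobi) brk_tens.
exact: linearZ.
Qed.

(** [u |-> u . 1] for the module structure of [bernop] on [S]. *)
Definition PBW_inv : Ut br X t -> S := @Ut_act _ _ _ bern_rho 1 g br X t.

Lemma PBW_inv_linear : linear PBW_inv.
Proof. exact: Ut_act_linear bern_rep. Qed.
HB.instance Definition _ := GRing.isLinear.Build K (Ut br X t) S _ _ PBW_inv_linear.

Lemma PBW_inv1 : PBW_inv 1 = 1.
Proof. exact: Ut_act1 bern_rep. Qed.

Lemma PBW_inv_to x u :
  PBW_inv (to_Ut br X t x * u) = bernop tstruct (tens (coords x) (PBW_inv u)).
Proof. by rewrite -bern_lin_act; apply: Ut_act_to bern_rep _ _. Qed.

(** Euler induction: [L (I (Eu p)) = sum_i L (e_i I (d^i p))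
    = sum_i rho_(e_i) (d^i p) = Eu p]. *)
Lemma I_PBWK : cancel (I_PBW br X t) PBW_inv.
Proof.
apply: (euler_ind charK) => [c p q hp hq||p hp].
- by rewrite !linearP /= hp hq.
- by rewrite I_PBW1 // PBW_inv1.
rewrite I_PBW_euler // linear_sum -(bernop_grad charK tstruct_anti).
transitivity (\sum_i bernop tstruct (tens (coords (tnth X i)) p^`M(i))).
  by apply: eq_bigr => i _; rewrite /= PBW_inv_to hp.
rewrite -linear_sum; congr bernop; apply/ffunP => k; rewrite sum_ffunE ffunE.
rewrite (bigD1 k) //= ffunE /coords coord_tnth // eqxx scale1r big1 ?addr0 // => i.
by move/negbTE => ne_ik; rewrite ffunE coord_tnth // ne_ik scale0r.
Qed.

End LieCoord.

(** * Surjectivity of the symmetrization map *)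

Section UtInd.
Variables (K : fieldType) (g : vectType K) (br : g -> g -> g).
Variables (n : nat) (X : n.-tuple g) (t : K).
Hypothesis X_basis : basis_of fullv X.
Local Notation T := (tensor_algebra K n).

Lemma to_tensor_algebra_tnth i :
  to_tensor_algebra X (tnth X i) = << fmu i >> :> T.
Proof.
rewrite /to_tensor_algebra (bigD1 i) //= coord_tnth // eqxx scale1r.
by rewrite big1 ?addr0 // => j ne_ji; rewrite coord_tnth // eq_sym (negbTE ne_ji) scale0r.
Qed.

Lemma Ut_ind (P : Ut br X t -> Prop) :
    (forall c u v, P u -> P v -> P (c *: u + v)) -> P 1 ->
    (forall i u, P u -> P (to_Ut br X t (tnth X i) * u)) ->
  forall u, P u.
Proof.
move=> PD P1 PM u; rewrite -[u]areprK.
elim/(@tensor_algebra_ind K n): (arepr u) => [|[s]|c a b IHa IHb].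
- have := PD (-1) _ _ P1 P1; rewrite scaleN1r addNr.
  by rewrite (_ : api _ 0 = 0) //; exact: linear0.
- elim: s => [|i s IH].
    have -> : (<< FMonom [::] >> : T) = 1 by congr << _ >>; apply: val_inj; rewrite /= fm1.
    exact: P1.
  have -> : (<< FMonom (i :: s) >> : T) = to_tensor_algebra X (tnth X i) * << FMonom s >>.
    rewrite to_tensor_algebra_tnth malgU_fmM; congr << _ >>; apply: val_inj.
    by rewrite /= fmM fmU.
  rewrite apiM; exact: PM.
rewrite (api_is_linear _ c a b); exact: PD.
Qed.

End UtInd.

(** The surjectivity of symmetrization uses only the Euler recursion and that
    commutators of generators are combinations of generators, so it is stated for
    a linear map into any algebra. *)

Section Surjective.
Variables (K : fieldType) (n : nat) (A : algType K).
Local Notation S := {mpoly K[n]}.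
Variables (e : 'I_n -> A) (I : {linear S -> A}) (d : 'I_n -> 'I_n -> 'I_n -> K).
Hypothesis charK : [pchar K] =i pred0.
Hypothesis I_euler : forall p, I (mu (grad p)) = \sum_i e i * I p^`M(i).
Hypothesis e_comm : forall i j, e i * e j = e j * e i + \sum_l d i j l *: e l.

(** The image of the polynomials of degree less than [k]. *)
Definition filt k (u : A) := exists2 p : S, (msize p <= k)%N & u = I p.

Lemma filtZD k c u v : filt k u -> filt k v -> filt k (c *: u + v).
Proof.
move=> [p hp ->] [q hq ->]; exists (c *: p + q); last by rewrite linearP.
apply/msize_leP => m le_m; move/msize_leP: hp => hp; move/msize_leP: hq => hq.
by rewrite mcoeffD mcoeffZ hp ?hq ?mulr0 ?addr0.
Qed.

Lemma filt_I k p : (msize p <= k)%N -> filt k (I p).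
Proof. by exists p. Qed.

Lemma filt0 k : filt k 0.
Proof. by exists 0; rewrite ?linear0 // msize0. Qed.

Lemma filtZ k c u : filt k u -> filt k (c *: u).
Proof. by move=> hu; rewrite -[_ *: _]addr0; apply: filtZD (filt0 k). Qed.

Lemma filtD k u v : filt k u -> filt k v -> filt k (u + v).
Proof. by move=> hu hv; rewrite -[u]scale1r; apply: filtZD. Qed.

Lemma filt_sum k (J : finType) (u : J -> A) :
  (forall j, filt k (u j)) -> filt k (\sum_j u j).
Proof. by move=> h; apply: big_ind => //; [exact: filt0 | exact: filtD]. Qed.

Lemma filtW k k' u : (k <= k')%N -> filt k u -> filt k' u.
Proof. by move=> le_k [p hp ->]; apply/filt_I/(leq_trans hp). Qed.

(** For a monomial [p] of degree [N] the recursion gives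
    [(1 + N) I (X_i p) = e_i I p + sum_j e_j I (X_i d^j p)] and
    [N e_i I p = sum_j e_i e_j I (d^j p)].  So the difference sought is, up to the
    factor [1 + N], a sum of terms [e_j (e_i I (d^j p) - I (X_i d^j p))] and of
    commutator terms [[e_i, e_j] I (d^j p)], to which the induction hypothesis
    applies as [d^j p] has smaller degree. *)
Lemma filt_mul k p i : (msize p <= k)%N -> filt k (e i * I p - I ('X_i * p)).
Proof.
elim: k => [|k IH] in p i *.
  rewrite leqn0 msize_poly_eq0 => /eqP ->.
  by rewrite mulr0 linear0 mulr0 subr0; exact: filt0.
have IHM q l : (msize q <= k)%N -> filt k.+1 (e l * I q).
  move=> hq; rewrite -[e l * _](subrK (I ('X_l * q))).
  by apply: filtD; [apply: filtW (IH q l hq) | apply/filt_I/msize_varM].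
move=> hp; rewrite [p]mpolyE mulr_sumr !linear_sum mulr_sumr -big_split big_seq /=.
apply: big_ind => [||m /msize_mdeg_lt/leq_trans/(_ hp) lt_mk].
- exact: filt0.
- exact: filtD.
rewrite -scalerAr !linearZ /= -scalerAr -scalerDr; apply: filtZ.
have hd j : (msize ('X_[m] : S)^`M(j) <= k)%N.
  by apply: msize_mderiv; rewrite msizeX.
set q : S := 'X_[m] in hd *; set d1 := (mdeg m)%:R : K.
have d1_neq0 : 1 + d1 != 0 by rewrite /d1 -mulrS ((pcharf0P K).1 charK).
have E1 : (1 + d1) *: I ('X_i * q) = e i * I q + \sum_j e j * I ('X_i * q^`M(j)).
  have := mu_gradX K (U_(i) + m)%MM; rewrite mdegD mdeg1 natrD mpolyXD => h.
  rewrite -linearZ -h I_euler.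
  transitivity (\sum_j (e j * I ((i == j)%:R *: q) + e j * I ('X_i * q^`M(j)))).
    apply: eq_bigr => j _; rewrite mderivM linearD mulrDr mderiv_var.
    by congr (e j * I _ + _); case: eqP; rewrite ?mul1r ?scale1r ?mul0r ?scale0r.
  rewrite big_split /= (bigD1 i) //= eqxx scale1r big1 ?addr0 // => j.
  by move/negbTE; rewrite eq_sym => ->; rewrite scale0r linear0 mulr0.
have E2 : d1 *: (e i * I q) = \sum_j e j * (e i * I q^`M(j))
                             + \sum_j \sum_l d i j l *: (e l * I q^`M(j)).
  rewrite scalerAr -linearZ -mu_gradX I_euler mulr_sumr -big_split.
  apply: eq_bigr => j _ /=; rewrite [LHS]mulrA e_comm mulrDl -mulrA mulr_suml.
  by congr (_ + _); apply: eq_bigr => l _; rewrite scalerAl.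
have -> : e i * I q - I ('X_i * q)
    = (1 + d1)^-1 *: (\sum_j e j * (e i * I q^`M(j) - I ('X_i * q^`M(j)))
                      + \sum_j \sum_l d i j l *: (e l * I q^`M(j))).
  apply: (scalerI d1_neq0); rewrite scalerA divff // scale1r scalerBr E1.
  under [X in _ = X + _]eq_bigr do rewrite mulrBr.
  rewrite sumrB scalerDl scale1r E2 opprD addrACA subrr add0r.
  by rewrite addrAC.
apply: filtZ; apply: filtD; apply: filt_sum => j.
  by have [r hr ->] := IH _ i (hd j); exact: IHM.
by apply: filt_sum => l; apply/filtZ/IHM.
Qed.

Lemma filt_var_mul u i : (exists p, u = I p) -> exists p, e i * u = I p.
Proof.
move=> [p ->]; have [r _ h] := filt_mul i (leqnn (msize p)).
by exists (r + 'X_i * p); rewrite linearD -h subrK.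
Qed.

End Surjective.

(** * The star product as a transported product *)

Section Star.
Variables (K : fieldType) (g : vectType K) (br : g -> g -> g).
Variables (n : nat) (X : n.-tuple g).
Hypothesis hbr : lie_bracket br.
Hypothesis charK : [pchar K] =i pred0.
Hypothesis X_basis : basis_of fullv X.
Local Notation S := {mpoly K[n]}.

Section Fixed.
Variable t : K.
Local Notation Ut := (Ut br X t).
Local Notation e := (fun i => to_Ut br X t (tnth X i)).
Local Notation I := (I_PBW br X t).
Local Notation L := (@PBW_inv K g br n X t).

Lemma to_Ut_comm i j : e i * e j = e j * e i + \sum_l tstruct br X t i j l *: e l.
Proof.
apply: sub_eq_addl; apply: etrans (to_Ut_bracket _ _ _ _ _) _.
rewrite {1}(coord_sum X_basis (br _ _)) (linear_comb (@to_Ut_linear _ _ br _ X t)).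
by rewrite scaler_sumr; apply: eq_bigr => l _; rewrite scalerA.
Qed.

Lemma I_PBW_surj (u : Ut) : exists p, u = I p.
Proof.
move: u; apply: (Ut_ind X_basis) => [c u v [p ->] [q ->]||i u hu].
- by exists (c *: p + q); exact/esym/I_PBW_linear.
- by exists 1; exact/esym/I_PBW1.
have := filt_var_mul (e := e) (I := I) charK.
apply; [exact: I_PBW_euler | exact: to_Ut_comm | exact: hu].
Qed.

Variable V : vectType K.
Local Notation F := (F_PBW br X t (V := V)).

(** [Id (x) L], the inverse of [F_PBW]. *)
Definition F_PBW_left (u : Q_tau br X V t) : C_tau n V :=
  tensor_lift (fun A a => tpure A (L a)) u.

Lemma F_PBW_left_linear : linear F_PBW_left.
Proof.
have [pl pr] := @tpure_bilinear K 'End(V) S.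
apply: tensor_lift_linear; split=> [b c f h|f c b d] /=; first exact: pl.
rewrite (PBW_inv_linear hbr X_basis charK); exact: pr.
Qed.

Lemma F_PBW_left_pure A u : F_PBW_left (tpure A u) = tpure A (L u).
Proof.
have [pl pr] := @tpure_bilinear K 'End(V) S.
apply: tensor_lift_pure; split=> [b c f h|f c b d] /=; first exact: pl.
rewrite (PBW_inv_linear hbr X_basis charK); exact: pr.
Qed.

Lemma F_PBW_linear : linear F.
Proof.
have [pl pr] := @tpure_bilinear K 'End(V) Ut.
apply: tensor_lift_linear; split=> [b c f h|f c b d] /=; first exact: pl.
rewrite I_PBW_linear; exact: pr.
Qed.

Lemma F_PBWK : cancel F F_PBW_left.
Proof.
elim/tensor_ind => [A a||c u v IHu IHv].
- by rewrite F_PBW_pure F_PBW_left_pure I_PBWK.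
- by rewrite (linear_fun0 F_PBW_linear) (linear_fun0 F_PBW_left_linear).
by rewrite F_PBW_linear F_PBW_left_linear IHu IHv.
Qed.

Lemma F_PBW_surj v : exists u, F u = v.
Proof.
elim/tensor_ind: v => [A a||c v w [u <-] [u' <-]].
- by have [p ->] := I_PBW_surj a; exists (tpure A p); exact: F_PBW_pure.
- by exists 0; exact: linear_fun0 F_PBW_linear.
by exists (c *: u + u'); exact: F_PBW_linear.
Qed.

(** The preimage of [v] that [F_PBW_inv] chooses exists by surjectivity, and
    [F_PBW_left] recovers it from [v]. *)
Lemma F_PBW_invE v : F_PBW_inv v = F_PBW_left v.
Proof.
have hv : F (F_PBW_inv v) = v.
  by have [u hu] := F_PBW_surj v; exact: (@xgetI _ 0 [set w | F w = v]%classic u hu).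
exact: etrans (esym (F_PBWK _)) (congr1 F_PBW_left hv).
Qed.

Lemma star_bilinear : bilinear_for *:%R *:%R (star br X t (V := V)).
Proof.
have [sl sr] := transport_bilinear F_PBW_linear F_PBW_left_linear
  (tensor_map2_bilinear (@comp_lfun_bilinear K V) (@algebra_mul_bilinear K Ut)).
by split=> [v c u u'|u c v v'] /=; rewrite /star !F_PBW_invE; [exact: sl | exact: sr].
Qed.

Lemma star_pure (A B : 'End(V)) (a b : S) :
  star br X t (tpure A a) (tpure B b) = tpure (A \o B)%VF (L (I a * I b)).
Proof.
rewrite /star F_PBW_invE; apply: etrans (F_PBW_left_pure _ _); congr F_PBW_left.
apply: etrans (Q_tau_mul_pure _ _ _ _).
exact: congr2 (F_PBW_pure _ _ _ _ _) (F_PBW_pure _ _ _ _ _).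
Qed.

End Fixed.
End Star.

(** * Polynomial families up to second order *)

Section Jets.
Variables (K : fieldType) (W : lmodType K).

Definition polyfun (f : K -> W) :=
  exists N (D : nat -> W), forall t, f t = \sum_(k < N) t ^+ k *: D k.

Lemma polyfun_lin c f h : polyfun f -> polyfun h -> polyfun (fun t => c *: f t + h t).
Proof.
move=> [N [D hD]] [N' [D' hD']].
have pad M M' (E : nat -> W) t : (M <= M')%N ->
    \sum_(k < M) t ^+ k *: E k
    = \sum_(k < M') t ^+ k *: (if (k < M)%N then E k else 0).
  move=> le_M; rewrite (big_ord_widen M' (fun k => t ^+ k *: E k) le_M) big_mkcond.
  by apply: eq_bigr => k _; case: ifP; rewrite ?scaler0.
exists (maxn N N'), (fun k => c *: (if (k < N)%N then D k else 0)
                              + (if (k < N')%N then D' k else 0)) => t.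
rewrite hD hD' (pad N (maxn N N')) ?leq_maxl // (pad N' (maxn N N')) ?leq_maxr //.
rewrite scaler_sumr -big_split; apply: eq_bigr => k _ /=.
by rewrite scalerDr !scalerA mulrC.
Qed.

Lemma polyfun0 : polyfun (fun=> 0).
Proof. by exists 0%N, (fun=> 0) => t; rewrite big_ord0. Qed.

Lemma polyfun_cst w : polyfun (fun=> w).
Proof. by exists 1%N, (fun=> w) => t; rewrite big_ord1 scale1r. Qed.

Lemma polyfun_mul f : polyfun f -> polyfun (fun t => t *: f t).
Proof.
move=> [N [D hD]]; exists N.+1, (fun k => if k is k'.+1 then D k' else 0) => t.
rewrite big_ord_recl scaler0 add0r hD scaler_sumr; apply: eq_bigr => k _.
by rewrite scalerA -exprS.
Qed.

Definition jet (f : K -> W) (w0 w1 : W) :=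
  exists2 r, polyfun r & forall t, f t = w0 + t *: w1 + t ^+ 2 *: r t.

Lemma jet_ext f h w0 w1 w0' w1' :
  f =1 h -> w0 = w0' -> w1 = w1' -> jet f w0 w1 -> jet h w0' w1'.
Proof. by move=> e <- <- [r hr er]; exists r => // t; rewrite -e. Qed.

Lemma jet_lin c f h f0 f1 h0 h1 : jet f f0 f1 -> jet h h0 h1 ->
  jet (fun t => c *: f t + h t) (c *: f0 + h0) (c *: f1 + h1).
Proof.
move=> [r hr er] [s hs es]; exists (fun t => c *: r t + s t).
  exact: polyfun_lin.
move=> t; rewrite er es !scalerDr !scalerA ![_ * c]mulrC.
by rewrite addrACA; congr (_ + _); exact: addrACA.
Qed.

Lemma jet_cst w : jet (fun=> w) w 0.
Proof. by exists (fun=> 0); [exact: polyfun0 | move=> t; rewrite !scaler0 !addr0]. Qed.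

Lemma jetD f h f0 f1 h0 h1 : jet f f0 f1 -> jet h h0 h1 ->
  jet (fun t => f t + h t) (f0 + h0) (f1 + h1).
Proof.
move=> hf hh; have := jet_lin 1 hf hh; apply: jet_ext => [t||].
all: exact: congr2 (scale1r _) erefl.
Qed.

Lemma jet_mul f f0 f1 : jet f f0 f1 -> jet (fun t => t *: f t) 0 f0.
Proof.
move=> [r hr er]; exists (fun t => 1 *: (fun=> f1) t + t *: r t).
  by apply: polyfun_lin; [exact: polyfun_cst | exact: polyfun_mul].
move=> t; rewrite er add0r !scalerDr scale1r !scalerA -!expr2 -exprSr -exprS.
by rewrite addrA.
Qed.

Lemma jet_sum (J : finType) (f : J -> K -> W) (f0 f1 : J -> W) :
  (forall j, jet (f j) (f0 j) (f1 j)) ->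
  jet (fun t => \sum_j f j t) (\sum_j f0 j) (\sum_j f1 j).
Proof.
move=> h; elim: (index_enum J) => [|j s IH].
  by apply: jet_ext (jet_cst 0) => [t||]; rewrite big_nil.
by apply: jet_ext (jetD (h j) IH) => [t||]; rewrite big_cons.
Qed.

Lemma polyfun_ext (f h : K -> W) : f =1 h -> polyfun f -> polyfun h.
Proof. by move=> e [N [D hD]]; exists N, D => t; rewrite -e. Qed.

Lemma polyfun_exp k (f : K -> W) : polyfun f -> polyfun (fun t => t ^+ k *: f t).
Proof.
move=> hf; elim: k => [|k IH]; first by apply: polyfun_ext hf => t; rewrite scale1r.
by apply: polyfun_ext (polyfun_mul IH) => t; rewrite scalerA -exprS.
Qed.

Lemma polyfunD (f h : K -> W) : polyfun f -> polyfun h -> polyfun (fun t => f t + h t).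
Proof.
move=> hf hh; apply: polyfun_ext (polyfun_lin 1 hf hh) => t.
by rewrite scale1r.
Qed.

Lemma polyfun_sum N (f : nat -> K -> W) :
  (forall k, polyfun (f k)) -> polyfun (fun t => \sum_(k < N) f k t).
Proof.
move=> h; elim: N => [|N IH].
  by apply: polyfun_ext polyfun0 => t; rewrite big_ord0.
by apply: polyfun_ext (polyfunD IH (h N)) => t; rewrite big_ord_recr.
Qed.

Lemma jet_polyfun f f0 f1 : jet f f0 f1 -> polyfun f.
Proof.
move=> [r hr er]; apply: polyfun_ext (fun t => esym (er t)) _.
apply: polyfunD (polyfun_exp 2 hr).
by apply: polyfunD (polyfun_cst f0) (polyfun_mul (polyfun_cst f1)).
Qed.

Lemma jet_order2 r : polyfun r -> jet (fun t => t ^+ 2 *: r t) 0 0.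
Proof. by move=> hr; exists r => // t; rewrite scaler0 !add0r. Qed.

End Jets.

(** The product rule for a family of linear maps applied to a family of vectors.
    The bound on the number of terms may depend on the vector, so [R t] is
    expanded separately on each coefficient of [f]. *)
Lemma jet_family (K : fieldType) (W W' : lmodType K) (R : K -> W -> W') R0 R1
    (f : K -> W) f0 f1 :
    (forall t, linear (R t)) -> (forall w, jet (R^~ w) (R0 w) (R1 w)) ->
    jet f f0 f1 ->
  jet (fun t => R t (f t)) (R0 f0) (R1 f0 + R0 f1).
Proof.
move=> Rl Rj [r [N [D hD]] er].
have hC : polyfun (fun t => \sum_(k < N) t ^+ k *: R t (D k)).
  apply: (@polyfun_sum _ _ N (fun k t => t ^+ k *: R t (D k))) => k.
  exact/polyfun_exp/jet_polyfun/Rj.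
apply: jet_ext (jetD (jetD (Rj f0) (jet_mul (Rj f1))) (jet_order2 hC)) => [t||].
- have RD u v : R t (u + v) = R t u + R t v.
    by have := Rl t 1 u v; rewrite !scale1r.
  have RZ c u : R t (c *: u) = c *: R t u.
    by rewrite -[c *: u]addr0 Rl (linear_fun0 (Rl t)) addr0.
  by rewrite er hD !RD !RZ (linear_comb (Rl t)).
- by rewrite !addr0.
- by rewrite addr0.
Qed.

Lemma jet_linear (K : fieldType) (W W' : lmodType K) (f : W -> W')
    (h : K -> W) h0 h1 :
  linear f -> jet h h0 h1 -> jet (fun t => f (h t)) (f h0) (f h1).
Proof.
move=> fl hh; have := jet_family (fun=> fl) (fun w => jet_cst (f w)) hh.
by apply: jet_ext => //; rewrite add0r.
Qed.

Lemma jet_tensor_ind (K : fieldType) (E A W : lmodType K)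
    (F : K -> tensor E A -> W) (m q : tensor E A -> W) :
    (forall t, linear (F t)) -> linear m -> linear q ->
    (forall x a, jet (F^~ (tpure x a)) (m (tpure x a)) (q (tpure x a))) ->
  forall u, jet (F^~ u) (m u) (q u).
Proof.
move=> Fl ml ql pure; elim/tensor_ind => [x a||c u v IHu IHv]; first exact: pure.
  apply: jet_ext (jet_cst 0) => [t||]; apply/esym; exact: linear_fun0.
by apply: jet_ext (jet_lin c IHu IHv) => [t||]; apply/esym; [exact: Fl|exact: ml|exact: ql].
Qed.

(** * The first-order term of the star product *)

Section FirstOrder.
Variables (K : fieldType) (g : vectType K) (br : g -> g -> g).
Variables (n : nat) (X : n.-tuple g).
Hypothesis hbr : lie_bracket br.
Hypothesis charK : [pchar K] =i pred0.
Hypothesis X_basis : basis_of fullv X.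
Local Notation S := {mpoly K[n]}.
Local Notation c := (struct_const br X).
Local Notation L t := (@PBW_inv K g br n X t).

Lemma delta_tstruct t w : delta (tstruct br X t) w = t *: delta c w.
Proof.
apply/ffunP => l; rewrite !ffunE scaler_sumr; apply: eq_bigr => i _.
by rewrite scaler_sumr; apply: eq_bigr => k _; rewrite scalerA.
Qed.

Lemma iter_delta_tstruct t m w :
  iter m (delta (tstruct br X t)) w = t ^+ m *: iter m (delta c) w.
Proof.
elim: m => [|m IH]; first by rewrite scale1r.
by rewrite !iterS IH delta_tstruct linearZ /= scalerA exprS.
Qed.

(** The first two coefficients of [phi] are 1 and -1/2. *)
Lemma jet_bernop w :
  jet (fun t => bernop (tstruct br X t) w) (mu w) (- 2^-1 *: mu (delta c w)).
Proof.
exists (fun t => \sum_(k < wsize w) t ^+ k *: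
                   (bern K k.+2 *: mu (iter k.+2 (delta c) w))).
  by exists (wsize w), (fun k => bern K k.+2 *: mu (iter k.+2 (delta c) w)).
(* Two terms more than needed, to split off the orders 0 and 1 for every [w]. *)
move=> t; rewrite (@bernopE _ _ _ (wsize w).+2); last exact/leqW/leqnSn.
rewrite !big_ord_recl !linearD /= bern0 bern1 !linearZ /= scale1r delta_tstruct.
rewrite linearZ /= !scalerA mulrC addrA; congr (_ + _).
rewrite linear_sum scaler_sumr; apply: eq_bigr => k _.
rewrite linearZ /= -!iterS iter_delta_tstruct linearZ /= !scalerA; congr (_ *: _).
by rewrite mulrC mulrA -exprD.
Qed.

(** The bracket [[e_i, e_j]] as a linear polynomial. *)
Definition brvar i j : S := \sum_k c i j k *: 'X_k.

Lemma poissonE a b :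
  poisson br X a b = \sum_i \sum_j brvar i j * a^`M(i) * b^`M(j).
Proof.
apply: eq_bigr => i _; apply: eq_bigr => j _; rewrite /brvar !mulr_suml.
by apply: eq_bigr => k _; rewrite -!scalerAl.
Qed.

Lemma brvar_anti i j : brvar i j = - brvar j i.
Proof.
rewrite -sumrN; apply: eq_bigr => k _; rewrite -scaleNr; congr (_ *: _).
by rewrite /struct_const lie_skew // linearN.
Qed.

Lemma poisson_var i q : poisson br X 'X_i q = \sum_j brvar i j * q^`M(j).
Proof.
rewrite poissonE (bigD1 i) //= [X in _ + X]big1 ?addr0 => [|j ne_ji]; last first.
  by rewrite big1 // => k _; rewrite mderiv_var eq_sym (negbTE ne_ji) mulr0 mul0r.
by apply: eq_bigr => j _; rewrite mderiv_var eqxx mulr1.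
Qed.

(** The term of order 1 in [rho_(e_i) q] is [t/2 {X_i, q}]; the sign comes from
    [delta] bracketing on the left. *)
Lemma mu_delta_tens i q :
  - mu (delta c (tens (coords X (tnth X i)) q)) = poisson br X 'X_i q.
Proof.
rewrite poisson_var /mu.
transitivity (- \sum_l \sum_j 'X_l * (c j i l *: q^`M(j))).
  congr (- _); apply: eq_bigr => l _; rewrite ffunE mulr_sumr.
  apply: eq_bigr => j _; congr (_ * _); rewrite (bigD1 i) //= big1 ?addr0 => [|k ne_ki].
    by rewrite ffunE /coords coord_tnth // eqxx scale1r.
  by rewrite ffunE /coords coord_tnth // eq_sym (negbTE ne_ki) scale0r linear0 scaler0.
rewrite exchange_big -sumrN; apply: eq_bigr => j _; rewrite mulr_suml -sumrN.
apply: eq_bigr => l _; rewrite -scalerAr -scalerAl -scaleNr; congr (_ *: _).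
by rewrite /struct_const (lie_skew hbr (tnth X i)) linearN.
Qed.

Lemma mu_tens i q : mu (tens (coords X (tnth X i)) q) = 'X_i * q.
Proof.
rewrite /mu (bigD1 i) //= big1 ?addr0 => [|k ne_ki].
  by rewrite ffunE /coords coord_tnth // eqxx scale1r.
by rewrite ffunE /coords coord_tnth // eq_sym (negbTE ne_ki) scale0r mulr0.
Qed.

Lemma mderiv_mu_grad (p : S) j :
  (mu (grad p))^`M(j) = p^`M(j) + \sum_i 'X_i * p^`M(i)^`M(j).
Proof.
rewrite /mu mderiv_sum.
transitivity (\sum_i ((i == j)%:R * p^`M(j) + 'X_i * p^`M(i)^`M(j))).
  apply: eq_bigr => i _; rewrite ffunE mderivM mderiv_var.
  by case: eqP => [->|_]; rewrite // !mul0r.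
rewrite big_split /= (bigD1 j) //= eqxx mul1r big1 ?addr0 // => i.
by move/negbTE ->; rewrite mul0r.
Qed.

(** The recursion of the Poisson bracket along the Euler operator.  As [{_, b}] is
    a derivation, the left-hand side has the terms [{X_i, b} d^i p] in place of
    [{X_i, (d^i p) b}]; they have the same sum because
    [sum_i {X_i, d^i p} = sum_ij [e_i, e_j] d^i d^j p = 0]. *)
Lemma poisson_euler p b : poisson br X (mu (grad p)) b =
  \sum_i ('X_i * poisson br X p^`M(i) b + poisson br X 'X_i (p^`M(i) * b)).
Proof.
rewrite big_split /=.
have -> : \sum_i poisson br X 'X_i (p^`M(i) * b) = poisson br X p b.
  under eq_bigr => i _.
    rewrite poisson_var; under eq_bigr => j _ do rewrite mderivM mulrDr.
    rewrite big_split; over.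
  rewrite big_split /= [X in X + _](_ : _ = 0) ?add0r.
    by rewrite poissonE; do 2![apply: eq_bigr => ? _]; rewrite mulrA.
  apply: (antisym_sum_eq0 charK) => i j.
  by rewrite brvar_anti mderiv_comm mulNr.
transitivity (\sum_j \sum_k \sum_i 'X_i * (brvar j k * p^`M(i)^`M(j) * b^`M(k))
              + poisson br X p b).
  rewrite !poissonE -big_split; apply: eq_bigr => j _; rewrite -big_split.
  apply: eq_bigr => k _ /=; rewrite mderiv_mu_grad.
  move: (brvar j k) => v; rewrite addrC mulrDr mulrDl; congr (_ + _).
  rewrite mulr_sumr mulr_suml; apply: eq_bigr => i _; ring.
congr (_ + _).
transitivity (\sum_j \sum_i \sum_k 'X_i * (brvar j k * p^`M(i)^`M(j) * b^`M(k))).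
  by apply: eq_bigr => j _; exact: exchange_big.
rewrite exchange_big; apply: eq_bigr => i _; rewrite poissonE mulr_sumr.
by apply: eq_bigr => j _; rewrite mulr_sumr.
Qed.

(** Euler induction on [a] with [L (I (Eu a) * I b) =
    sum_i rho_(e_i) (L (I (d^i a) * I b))]. *)
Lemma jet_PBW_mul b a :
  jet (fun t => L t (I_PBW br X t a * I_PBW br X t b)) (a * b) (2^-1 *: poisson br X a b).
Proof.
move: a; apply: (euler_ind charK) => [e p q hp hq||p hp].
- apply: jet_ext (jet_lin e hp hq) => [t||].
  + rewrite I_PBW_linear mulrDl -scalerAl; exact/esym/(PBW_inv_linear hbr X_basis charK).
  + by rewrite mulrDl scalerAl.
  have [pl _] := poisson_bilinear br X.
  have /= -> := pl b e p q.
  by rewrite scalerDr !scalerA mulrC.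
- apply: jet_ext (jet_cst b) => [t||].
  + by rewrite I_PBW1 // mul1r I_PBWK.
  + by rewrite mul1r.
  rewrite poissonE big1 ?scaler0 // => i _; rewrite big1 // => j _.
  by rewrite (mderivC i 1) mulr0 mul0r.
pose R i t q := bernop (tstruct br X t) (tens (coords X (tnth X i)) q).
have Rl i t : linear (R i t) by move=> e u v; rewrite /R !linearP.
have Rj i q : jet (R i ^~ q) ('X_i * q) (2^-1 *: poisson br X 'X_i q).
  apply: jet_ext (jet_bernop _) => //; first exact: mu_tens.
  by rewrite scaleNr -scalerN mu_delta_tens.
apply: jet_ext (jet_sum (fun i => jet_family (Rl i) (Rj i) (hp i))) => [t||].
- rewrite I_PBW_euler // mulr_suml.
  rewrite (linear_fun_sum _ (PBW_inv_linear hbr X_basis charK (t := t))).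
  apply: eq_bigr => i _; apply/esym.
  apply: etrans (congr1 (L t) (esym (mulrA _ _ _))) _.
  exact: PBW_inv_to.
- rewrite /mu mulr_suml; apply: eq_bigr => i _; by rewrite ffunE mulrA.
rewrite poisson_euler scaler_sumr; apply: eq_bigr => i _.
by rewrite scalerDr addrC scalerAr.
Qed.

Variable V : vectType K.

Lemma C_tau_mul_bilinear :
  bilinear_for *:%R *:%R (@C_tau_mul K n V).
Proof.
apply: tensor_map2_bilinear; first exact: comp_lfun_bilinear.
exact: algebra_mul_bilinear.
Qed.

Lemma nc_poisson_bilinear :
  bilinear_for *:%R *:%R (@nc_poisson K g br n X V).
Proof.
apply: tensor_map2_bilinear; first exact: comp_lfun_bilinear.
exact: poisson_bilinear.
Qed.

Lemma jet_star (A B : C_tau n V) :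
  jet (fun t => star br X t A B) (C_tau_mul A B) (2^-1 *: nc_poisson br X A B).
Proof.
have [ml mr] := C_tau_mul_bilinear; have [pl pr] := nc_poisson_bilinear.
have sl t := (star_bilinear hbr charK X_basis t V).1.
have sr t := (star_bilinear hbr charK X_basis t V).2.
have halfl (f : C_tau n V -> C_tau n V) : linear f -> linear (fun u => 2^-1 *: f u).
  by move=> fl e u v; rewrite fl scalerDr !scalerA mulrC.
move: A; apply: jet_tensor_ind => [t|||A a]; [exact: sl | exact: ml | exact/halfl/pl |].
move: B; apply: jet_tensor_ind => [t|||B b]; [exact: sr | exact: mr | exact/halfl/pr |].
have [_ tr] := @tpure_bilinear K 'End(V) S.
apply: jet_ext (jet_linear (tr (A \o B)%VF) (jet_PBW_mul b a)) => [t||].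
- exact/esym/star_pure.
- exact/esym/C_tau_mul_pure.
rewrite nc_poisson_pure; have := tr (A \o B)%VF 2^-1 (poisson br X a b) 0.
by rewrite (linear_fun0 (tr _)) !addr0.
Qed.
End FirstOrder.

Theorem proposition4p6 (R : realType)
    (g : vectType R[i]) (br : g -> g -> g) (hbr : lie_bracket br)
    (V : vectType R[i]) (tau : g -> 'End(V)) (htau : lie_representation br tau)
    (n : nat) (X : n.-tuple g) (hX : basis_of fullv X)
    (A B : C_tau n V) :
  exists (N : nat) (D : nat -> C_tau n V), forall t : R[i],
    star br X t A B
    = C_tau_mul A B + (t / 2) *: nc_poisson br X A B
      + t ^+ 2 *: \sum_(k < N) t ^+ k *: D k.
Proof.
have [r [N [D hD]] er] := jet_star hbr (Num.Theory.pchar_num R[i]) hX A B.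
by exists N, D => t; rewrite er hD scalerA.
Qed.
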